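(* For $\mathrm{Re}(b) < \frac{1}{8}$, $${}_8F_{8}\left[ \begin{array}{cccccccc} a, & a +\frac{1}{2}, & a +\frac{1}{4}, & a +\frac{3}{4}, & b, & b +\frac{1}{2}, & b +\frac{1}{4}, & b +\frac{3}{4} \\ 1, & \frac{1}{2}, & \frac{1}{4}, & \frac{3}{4}, & \frac{1}{2}+a-b, & 1+a-b, & \frac{1}{4}+a-b, & \frac{3}{4}+a-b \end{array} \Big| \; 1 \right]$$ $$= \frac{1}{4} \left[ \frac{\Gamma(1+4a-4b)\, \Gamma(1-8b)}{\Gamma(1-4b)\, \Gamma(1+4a-8b)} + \frac{\Gamma(1+4a-4b)\, \Gamma(1+2a)}{\Gamma(1+4a)\, \Gamma(1+2a-4b)} \right] + \frac{\Gamma(1+2a-2b) \, \Gamma(\frac{1}{2}+2a-2b)}{2 \, \Gamma(1+2a) \,\Gamma(\frac{1}{2}+2a-4b)} \; {}_{3}F_2\left[ \begin{array}{ccc} \frac{1}{2}-a, & 2b, & 2b +\frac{1}{2}\\ & 1+a, & \frac{1}{2} \end{array} \Big| \; 1 \right].$$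
   Context: Here $a,b$ are complex numbers and $\Gamma$ is the classical gamma function. The classical generalized hypergeometric series is, with the convention used here, $${}_mF_{m}\left[ \begin{array}{ccc} a_1, & \dots, & a_m \\ b_1, & \dots, & b_m \end{array} \Big| \; z \right] :=\sum_{k=0}^{\infty} \frac{(a_1)_k \cdots (a_m)_k}{(b_1)_k \cdots (b_m)_k}\, z^k,$$ where $a_i$, $b_i$ and $z$ are complex numbers, with none of the $b_i$ being negative integers or zero, $m$ is a positive integer, $(a)_0:=1$ and $(a)_k:=a(a+1)\cdots(a+k-1)$ for a positive integer $k$ (no additional $k!$ in the denominator). Setting $b_1=1$ recovers the usual ${}_mF_{m-1}$, so ${}_3F_2\left[\begin{array}{ccc}a_1,&a_2,&a_3\\&b_2,&b_3\end{array}\Big|\;z\right]=\sum_{k\ge0}\frac{(a_1)_k(a_2)_k(a_3)_k}{(b_2)_k(b_3)_k}\frac{z^k}{k!}$.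
   Formalization: Added assumptions: the 3F2 series on the right converges (Re b < 1/8 alone does not ensure this; it diverges e.g. at a = -0.1, b = 0.1), and 1+2a is not zero or a negative integer (Γ(1+2a) would be undefined). *)

(* Defs.v *)
From Stdlib Require Export Reals Factorial.
From Coquelicot Require Export Coquelicot.
From Stdlib Require Export List.
Export ListNotations.
Open Scope C_scope.

Fixpoint pochhammer (a : C) (k : nat) : C :=
  match k with
  | O => 1
  | S j => pochhammer a j * (a + INR j)
  end.

Definition nonpos_int (z : C) : Prop := exists n : nat, z = - INR n.

Definition Cprod (l : list C) : C := fold_right Cmult 1 l.

(* No additional k! in the denominator: the classical mF(m-1) series is
   obtained by taking 1 as one of the lower parameters. *)
Definition hypF_term (la lb : list C) (z : C) (k : nat) : C :=
  Cprod (map (fun a => pochhammer a k) la)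
  / Cprod (map (fun b => pochhammer b k) lb) * z ^ k.

(* Sum of a complex series, meaningful when the series converges
   (see [CSeries_unique]). *)
Definition CSeries (u : nat -> C) : C :=
  (Series (fun k => Re (u k)), Series (fun k => Im (u k))).

Definition hypF (la lb : list C) (z : C) : C := CSeries (hypF_term la lb z).

Definition Cexp (z : C) : C :=
  (exp (Re z) * cos (Im z), exp (Re z) * sin (Im z))%R.

(* Euler's limit n! n^z / (z (z+1) ... (z+n)), which defines Gamma at every
   complex z other than 0, -1, -2, ....  Since x / 0 = 0, the value at those
   poles is 0 (see [Gamma_pole]); hence dividing by Gamma z is multiplying by
   the entire function 1/Gamma, also at its zeros. *)
Definition Gamma_seq (z : C) (n : nat) : C :=
  INR (fact n) * Cexp (z * ln (INR n)) / pochhammer z (S n).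

Definition Gamma (z : C) : C :=
  (real (Lim_seq (fun n => Re (Gamma_seq z n))),
   real (Lim_seq (fun n => Im (Gamma_seq z n)))).

Lemma is_lim_seq_Re (u : nat -> C) (l : C) :
  filterlim u eventually (locally l) -> is_lim_seq (fun n => Re (u n)) (Re l).
Proof.
intros H. apply (filterlim_comp _ _ _ u Re eventually (locally l)); [exact H|].
intros P [e He]. exists e. intros y [Hy _]. apply He. exact Hy.
Qed.

Lemma is_lim_seq_Im (u : nat -> C) (l : C) :
  filterlim u eventually (locally l) -> is_lim_seq (fun n => Im (u n)) (Im l).
Proof.
intros H. apply (filterlim_comp _ _ _ u Im eventually (locally l)); [exact H|].
intros P [e He]. exists e. intros y [_ Hy]. apply He. exact Hy.
Qed.

Lemma CSeries_unique (u : nat -> C) (l : C) : is_series u l -> CSeries u = l.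
Proof.
intros H. unfold CSeries.
rewrite (surjective_pairing l). f_equal; apply is_series_unique.
- apply (filterlim_ext (fun n => Re (sum_n u n))).
  + induction x as [|n IH].
    * now rewrite !sum_O.
    * rewrite !sum_Sn. now rewrite <- IH.
  + now apply is_lim_seq_Re.
- apply (filterlim_ext (fun n => Im (sum_n u n))).
  + induction x as [|n IH].
    * now rewrite !sum_O.
    * rewrite !sum_Sn. now rewrite <- IH.
  + now apply is_lim_seq_Im.
Qed.

Lemma Gamma_unique (z l : C) :
  filterlim (Gamma_seq z) eventually (locally l) -> Gamma z = l.
Proof.
intros H. unfold Gamma.
rewrite (is_lim_seq_unique _ _ (is_lim_seq_Re _ _ H)).
rewrite (is_lim_seq_unique _ _ (is_lim_seq_Im _ _ H)).
now destruct l.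
Qed.

Lemma Cinv_0 : / (0 : C) = 0.
Proof. unfold Cinv, Rdiv; simpl. apply injective_projections; simpl; ring. Qed.

Lemma pochhammer_nonpos_int (m k : nat) :
  (m < k)%nat -> pochhammer (- INR m) k = 0.
Proof.
induction 1 as [|k _ IH]; simpl.
- ring.
- rewrite IH. ring.
Qed.

Lemma Gamma_pole (z : C) : nonpos_int z -> Gamma z = 0.
Proof.
intros [m ->]. apply Gamma_unique.
apply filterlim_ext_loc with (f := fun _ => RtoC 0).
- exists m. intros n Hn. unfold Gamma_seq, Cdiv.
  rewrite pochhammer_nonpos_int by now apply PeanoNat.Nat.lt_succ_r.
  rewrite Cinv_0. ring.
- apply filterlim_const.
Qed.

(* Main.v *)
Require Import Defs.
From Stdlib Require Import Lra Lia.
Open Scope C_scope.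

(** With A = 4a and B = 4b the left-hand side is the sum of every fourth term of
    T_k = (A)_k (B)_k / (k! (1+A-B)_k), so by bisecting twice it equals
    (S_1 + S_2)/4 + S_3/2, where S_1 = sum T_k is given by Gauss' theorem,
    S_2 = sum (-1)^k T_k by Kummer's, and S_3 = sum (-1)^k T_(2k) is a well-poised
    4F3(-1).  Whipple's transformation turns S_3 into the 3F2(1): expand
    (d)_n (e)_n / ((1+a-d)_n (1+a-e)_n) by Gauss' theorem and interchange the sums,
    the inner one being a terminating case of Dixon's theorem (Bailey's lemma).
    The same transformation gives Kummer's theorem for Re A > 0, and a contiguous
    relation A -> A + 2 extends it.  Convergence of the 3F2 forces its excess to
    have positive real part unless the series terminates. *)

(* [sum_n] types its value in a Coquelicot structure, where [ring] and [field]
   do not recognize the equality as one in [C]. *)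
Ltac C_eq := match goal with |- ?x = ?y => change (@eq C x y) end.
Ltac R_eq := match goal with |- ?x = ?y => change (@eq R x y) end.

(** * Limits of complex sequences *)

(** Evaluations by Gamma values are stated with reciprocals, as in
    [/ Gamma x * / Gamma y * F = ...]. The function [/ Gamma] is the limit of [Gamma_ratio] at every
    point, poles included, so these identities stay valid when an argument hits a pole, and the step
    [A -> A + 2] in Kummer's theorem can cross poles. Reciprocals are cleared only where the Gamma
    value is known to be nonzero.

    The limit of [Gamma_ratio] also yields the growth rate of Pochhammer symbols, (z)_n / n! =
    O(n^(Re z - 1)), from which the convergence and domination estimates are derived.

    The interchange of sums is dominated when Re c - sigma < 1/2, where sigma is the real part of
    the excess of the 3F2. Here c = 2a + 1/2 and sigma = Re (1/2 + 2a - 4b), so this reads 4 Re b <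
    1/2: it is the source of the bound 1/8. The condition sigma > 0 has to be extracted from mere
    convergence of a series whose terms may rotate in the plane, so divergence of the moduli would
    not be enough. *)

Definition Clim (u : nat -> C) (l : C) : Prop :=
  filterlim u eventually (locally l).

(** [locally] on C comes from the product uniform structure, whose balls are squares rather than
    discs of [Cmod]; [locally_norm] mediates between the two. *)
Lemma Clim_Cmod_iff (u : nat -> C) (l : C) :
  Clim u l <-> is_lim_seq (fun n => Cmod (u n - l)) 0%R.
Proof.
rewrite <- is_lim_seq_spec. split.
- intros H eps.
  assert (Hl : locally_norm (l : C_NormedModule) (fun y => Cmod (y - l) < eps)%R)
    by (exists eps; intros y Hy; exact Hy).
  apply locally_le_locally_norm in Hl.
  destruct (H _ Hl) as [N HN]. exists N. intros n Hn.
  rewrite Rminus_0_r, Rabs_pos_eq by apply Cmod_ge_0. now apply HN.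
- intros H P HP. apply (locally_norm_le_locally (l : C_NormedModule)) in HP.
  destruct HP as [eps HP]. destruct (H eps) as [N HN]. exists N. intros n Hn.
  apply HP. specialize (HN n Hn).
  now rewrite Rminus_0_r, Rabs_pos_eq in HN by apply Cmod_ge_0.
Qed.

Lemma Clim_le (u : nat -> C) (l : C) (v : nat -> R) :
  (forall n, (Cmod (u n - l) <= v n)%R) -> is_lim_seq v 0%R -> Clim u l.
Proof.
intros H Hv. apply Clim_Cmod_iff.
apply (is_lim_seq_le_le (fun _ => 0%R) _ v); [|apply is_lim_seq_const|exact Hv].
intros n. split; [apply Cmod_ge_0|apply H].
Qed.

Lemma Clim_ext (u v : nat -> C) (l : C) :
  (forall n, u n = v n) -> Clim u l -> Clim v l.
Proof. intros H. apply filterlim_ext. exact H. Qed.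

Lemma Clim_ext_loc (u v : nat -> C) (l : C) N :
  (forall n, (N <= n)%nat -> u n = v n) -> Clim u l -> Clim v l.
Proof. intros H. apply filterlim_ext_loc. exists N. exact H. Qed.

Lemma Clim_const (l : C) : Clim (fun _ => l) l.
Proof. apply filterlim_const. Qed.

Lemma Clim_plus (u v : nat -> C) (a b : C) : Clim u a -> Clim v b -> Clim (fun n => u n + v n) (a + b).
Proof.
rewrite !Clim_Cmod_iff. intros Hu Hv.
apply Clim_Cmod_iff, (Clim_le _ _ (fun n => Cmod (u n - a) + Cmod (v n - b))%R).
- intros n. replace (u n + v n - (a + b)) with ((u n - a) + (v n - b)) by ring.
  apply Cmod_triangle.
- rewrite <- (Rplus_0_l 0). now apply is_lim_seq_plus'.
Qed.

Lemma Clim_Cmod u l : Clim u l -> is_lim_seq (fun n => Cmod (u n)) (Cmod l).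
Proof.
intros H. apply Clim_Cmod_iff in H.
assert (K : is_lim_seq (fun n => Cmod (u n) - Cmod l)%R 0%R).
{ apply is_lim_seq_abs_0.
  apply (is_lim_seq_le_le (fun _ => 0%R) _ (fun n => Cmod (u n - l)));
    [|apply is_lim_seq_const|exact H].
  intros n. split; [apply Rabs_pos|].
  apply Rabs_le. split.
  - assert (T := Cmod_triangle (- (u n - l)) (u n)).
    rewrite Cmod_opp in T. replace (- (u n - l) + u n) with l in T by ring. lra.
  - assert (T := Cmod_triangle (u n - l) l).
    replace (u n - l + l) with (u n) in T by ring. lra. }
apply is_lim_seq_ext with (fun n => (Cmod (u n) - Cmod l) + Cmod l)%R;
  [intros; ring|].
replace (Finite (Cmod l)) with (Finite (0 + Cmod l)) by (f_equal; ring).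
apply is_lim_seq_plus'; [exact K|apply is_lim_seq_const].
Qed.

Lemma is_lim_seq_bounded (v : nat -> R) (l : R) :
  is_lim_seq v l -> exists M, (0 < M)%R /\ forall n, (v n <= M)%R.
Proof.
intros H. apply is_lim_seq_spec in H. destruct (H (mkposreal 1 Rlt_0_1)) as [N HN].
simpl in HN.
assert (K : forall k, exists M, (0 < M)%R /\ forall n, (n < k)%nat -> (v n <= M)%R).
{ induction k as [|k [M [M0 HM]]].
  - exists 1%R. split; [lra|]. intros; lia.
  - exists (Rmax M (v k)). split; [assert (T := Rmax_l M (v k)); lra|].
    intros n Hn. assert (T := Rmax_l M (v k)). assert (T' := Rmax_r M (v k)).
    destruct (Nat.eq_dec n k) as [->|ne]; [lra|].
    specialize (HM n ltac:(lia)). lra. }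
destruct (K N) as [M [M0 HM]]. exists (M + (Rabs l + 1))%R.
assert (A := Rabs_pos l). split; [lra|]. intros n.
destruct (Nat.lt_ge_cases n N) as [h|h].
- specialize (HM n h). lra.
- specialize (HN n h). apply Rabs_lt_between in HN. assert (B := Rle_abs l). lra.
Qed.

Lemma Clim_bounded u l :
  Clim u l -> exists M, (0 < M)%R /\ forall n, (Cmod (u n) <= M)%R.
Proof. intros H. exact (is_lim_seq_bounded _ _ (Clim_Cmod _ _ H)). Qed.

Lemma Clim_mult (u v : nat -> C) (a b : C) : Clim u a -> Clim v b -> Clim (fun n => u n * v n) (a * b).
Proof.
intros Hu Hv. destruct (Clim_bounded _ _ Hu) as [M [M0 HM]].
apply Clim_Cmod_iff in Hu. apply Clim_Cmod_iff in Hv.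
apply (Clim_le _ _ (fun n => M * Cmod (v n - b) + Cmod b * Cmod (u n - a))%R).
- intros n. replace (u n * v n - a * b) with (u n * (v n - b) + b * (u n - a)) by ring.
  eapply Rle_trans; [apply Cmod_triangle|]. rewrite !Cmod_mult.
  apply Rplus_le_compat_r, Rmult_le_compat_r; [apply Cmod_ge_0|apply HM].
- replace (Finite 0) with (Finite (M * 0 + Cmod b * 0)) by (f_equal; ring).
  apply is_lim_seq_plus'; apply is_lim_seq_mult'; auto using is_lim_seq_const.
Qed.

Lemma Clim_inv (u : nat -> C) (a : C) : a <> 0 -> Clim u a -> Clim (fun n => / u n) (/ a).
Proof.
intros Ha Hu. assert (A := Clim_Cmod _ _ Hu). assert (Ha' := proj1 (Cmod_gt_0 a) Ha).
destruct (proj2 (is_lim_seq_spec _ _) A (mkposreal (Cmod a / 2) ltac:(lra))) as [N HN].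
simpl in HN.
apply Clim_Cmod_iff in Hu.
apply Clim_Cmod_iff.
apply (is_lim_seq_le_le_loc (fun _ => 0%R) _
  (fun n => Cmod (u n - a) * (2 / (Cmod a * Cmod a)))%R).
- exists N. intros n Hn. split; [apply Cmod_ge_0|].
  specialize (HN n Hn). apply Rabs_lt_between in HN.
  assert (Hun : u n <> 0) by (apply Cmod_gt_0; lra).
  replace (/ u n - / a) with (- (u n - a) * / (u n * a)) by (field; auto).
  rewrite Cmod_mult, Cmod_opp, Cmod_inv by now apply Cmult_neq_0.
  apply Rmult_le_compat_l; [apply Cmod_ge_0|]. rewrite Cmod_mult.
  replace (2 / (Cmod a * Cmod a))%R with (/ (Cmod a / 2 * Cmod a))%R by (field; lra).
  apply Rinv_le_contravar; [apply Rmult_lt_0_compat; lra|].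
  apply Rmult_le_compat_r; lra.
- apply is_lim_seq_const.
- replace (Finite 0) with (Finite (0 * (2 / (Cmod a * Cmod a)))) by (f_equal; ring).
  apply is_lim_seq_mult'; [exact Hu|apply is_lim_seq_const].
Qed.

Lemma Clim_unique u a b : Clim u a -> Clim u b -> a = b.
Proof.
intros Ha Hb.
rewrite (surjective_pairing a), (surjective_pairing b). f_equal.
- assert (T := is_lim_seq_unique _ _ (is_lim_seq_Re _ _ Ha)).
  rewrite (is_lim_seq_unique _ _ (is_lim_seq_Re _ _ Hb)) in T. now inversion T.
- assert (T := is_lim_seq_unique _ _ (is_lim_seq_Im _ _ Ha)).
  rewrite (is_lim_seq_unique _ _ (is_lim_seq_Im _ _ Hb)) in T. now inversion T.
Qed.

Lemma Clim_incr_1 u l : Clim u l <-> Clim (fun n => u (S n)) l.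
Proof.
rewrite !Clim_Cmod_iff.
apply (is_lim_seq_incr_1 (fun n => Cmod (u n - l))).
Qed.

(** * Partial sums and convergence criteria for series *)

Lemma sum_n_C_S (u : nat -> C) n : sum_n u (S n) = sum_n u n + u (S n).
Proof. rewrite sum_Sn. reflexivity. Qed.

Lemma sum_n_R_S (u : nat -> R) n : sum_n u (S n) = (sum_n u n + u (S n))%R.
Proof. rewrite sum_Sn. reflexivity. Qed.

Lemma Cmod_sum_n_le (u : nat -> C) n :
  (Cmod (sum_n u n) <= sum_n (fun k => Cmod (u k)) n)%R.
Proof.
induction n as [|n IH]; [rewrite !sum_O; apply Rle_refl|].
rewrite sum_n_C_S, sum_n_R_S. eapply Rle_trans; [apply Cmod_triangle|lra].
Qed.

Lemma ex_series_C_le (u : nat -> C) (v : nat -> R) :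
  (forall n, (Cmod (u n) <= v n)%R) -> ex_series v -> ex_series u.
Proof. intros H Hv. apply (@ex_series_le C_AbsRing C_CompleteNormedModule u v H Hv). Qed.

Lemma ex_series_pos_bounded (a : nat -> R) (M : R) :
  (forall n, (0 <= a n)%R) -> (forall n, (sum_n a n <= M)%R) -> ex_series a.
Proof.
intros H0 HM.
destruct (ex_finite_lim_seq_incr (sum_n a) M) as [l Hl].
- intros n. rewrite sum_n_R_S. specialize (H0 (S n)). lra.
- exact HM.
- exists l. exact Hl.
Qed.

Lemma is_series_sum_n (u : nat -> C) l : is_series u l <-> Clim (sum_n u) l.
Proof. reflexivity. Qed.

Lemma INR_S_pos n : (0 < INR (S n))%R.
Proof. apply lt_0_INR; lia. Qed.

(* From an index [N >= 4 K] on, the steps telescope against [1/n - 1/(n+1)], so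
   [u] stays within [|u N| / 2] of [u N]. *)
Lemma quadratic_product_cvg (u : nat -> C) (K : R) (N0 : nat) :
  (forall n, (N0 <= n)%nat ->
     (Cmod (u (S n) - u n) <= K / (INR (S n))^2 * Cmod (u n))%R) ->
  exists l, Clim u l /\ ((forall n, u n <> 0) -> l <> 0).
Proof.
intros H.
assert (exists N, (N0 <= N)%nat /\ (1 <= N)%nat /\ (4 * K <= INR N)%R) as [N [N1 [N2 N3]]].
{ destruct (INR_unbounded (4 * K)) as [p Hp].
  exists (N0 + p + 1)%nat. repeat split; try lia.
  rewrite !plus_INR. assert (T := pos_INR N0). simpl. lra. }
set (K' := Rmax K 0).
assert (HK' : (0 <= K')%R) by apply Rmax_r.
assert (HKK : (K <= K')%R) by apply Rmax_l.
assert (NP : (1 <= INR N)%R) by (apply (le_INR 1); lia).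
assert (N3' : (4 * K' <= INR N)%R) by (unfold K', Rmax; destruct Rle_dec; lra).
assert (tele : forall n, (/ (INR (S (N + n)))^2 <= / INR (N + n) - / INR (S (N + n)))%R).
{ intros n. rewrite S_INR. assert (1 <= INR (N + n))%R by (apply (le_INR 1); lia).
  replace (/ INR (N + n) - / (INR (N + n) + 1))%R with (/ (INR (N + n) * (INR (N + n) + 1)))%R
    by (field; lra).
  apply Rinv_le_contravar; nra. }
assert (B : forall n, (Cmod (u (N + n)%nat - u N) <=
   2 * K' * Cmod (u N) * (/ INR N - / INR (N + n)))%R
   /\ (Cmod (u (N + n)%nat) <= 2 * Cmod (u N))%R
   /\ (Cmod (u N) / 2 <= Cmod (u (N + n)%nat))%R).
{ assert (C0 := Cmod_ge_0 (u N)).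
  intros n.
  enough (E : (Cmod (u (N + n)%nat - u N) <=
   2 * K' * Cmod (u N) * (/ INR N - / INR (N + n)))%R
   /\ (Cmod (u (N + n)%nat) <= 2 * Cmod (u N))%R).
  (* The lower bound |u N| / 2, which keeps the limit away from 0, follows from the distance bound
     because 2 K' / N <= 1/2. *)
  { split; [apply E|split; [apply E|]]. destruct E as [E _].
    assert (T := Cmod_triangle (u (N + n)%nat) (-(u (N + n)%nat - u N))).
    rewrite Cmod_opp in T.
    replace (u (N + n)%nat + - (u (N + n)%nat - u N)) with (u N) in T by ring.
    assert (0 <= / INR (N + n))%R by (apply Rlt_le, Rinv_0_lt_compat, lt_0_INR; lia).
    assert (2 * K' * / INR N <= 1/2)%R.
    { apply Rmult_le_reg_r with (INR N); [lra|]. rewrite Rmult_assoc, Rinv_l by lra. lra. }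
    assert (2 * K' * Cmod (u N) * (/ INR N - / INR (N + n)) <= Cmod (u N) / 2)%R.
    { assert (0 <= K' * Cmod (u N))%R by nra. nra. }
    lra. }
  induction n as [|n [IH1 IH2]].
  - rewrite Nat.add_0_r. replace (u N - u N) with (RtoC 0) by ring. rewrite Cmod_0. split; lra.
  - assert (E : (Cmod (u (N + S n)%nat - u N) <=
      2 * K' * Cmod (u N) * (/ INR N - / INR (N + S n)))%R).
    { rewrite Nat.add_succ_r.
      replace (u (S (N + n)) - u N) with ((u (S (N + n)) - u (N + n)%nat) + (u (N + n)%nat - u N)) by ring.
      eapply Rle_trans; [apply Cmod_triangle|].
      assert (S1 := H (N + n)%nat ltac:(lia)). assert (S2 := tele n).
      assert (K / INR (S (N + n)) ^ 2 * Cmod (u (N + n)%nat) <=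
        K' * (/ INR (N + n) - / INR (S (N + n))) * (2 * Cmod (u N)))%R.
      { assert (P2 : (0 <= / INR (S (N + n)) ^ 2)%R).
        { apply Rlt_le, Rinv_0_lt_compat, pow_lt, INR_S_pos. }
        unfold Rdiv. apply Rle_trans with (K' * / INR (S (N + n)) ^ 2 * (2 * Cmod (u N)))%R.
        - assert (T := Cmod_ge_0 (u (N + n)%nat)).
          apply Rmult_le_compat_r with (r := (/ INR (S (N + n)) ^ 2)%R) in HKK; [|exact P2].
          apply Rle_trans with (K' * / INR (S (N + n)) ^ 2 * Cmod (u (N + n)%nat))%R.
          + apply Rmult_le_compat_r; assumption.
          + apply Rmult_le_compat_l; [apply Rmult_le_pos|]; assumption.
        - apply Rmult_le_compat_r; [lra|]. apply Rmult_le_compat_l; assumption. }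
      nra. }
    split; [exact E|].
    assert (T := Cmod_triangle (u (N + S n)%nat - u N) (u N)).
    replace (u (N + S n)%nat - u N + u N) with (u (N + S n)%nat) in T by ring.
    assert (0 <= / INR (N + S n))%R by (apply Rlt_le, Rinv_0_lt_compat, lt_0_INR; lia).
    assert (2 * K' * / INR N <= 1/2)%R.
    { apply Rmult_le_reg_r with (INR N); [lra|]. rewrite Rmult_assoc, Rinv_l by lra. lra. }
    assert (0 <= K' * Cmod (u N))%R by nra. nra. }
assert (Ex : ex_series (fun n => u (S (N + n)) - u (N + n)%nat)).
{ apply ex_series_C_le with (fun n => K' * (2 * Cmod (u N)) * / (INR (S (N + n)))^2)%R.
  - intros n. eapply Rle_trans; [apply H; lia|]. destruct (B n) as [_ [B2 _]].
    assert (P2 : (0 <= / INR (S (N + n)) ^ 2)%R).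
    { apply Rlt_le, Rinv_0_lt_compat, pow_lt, INR_S_pos. }
    assert (T := Cmod_ge_0 (u (N + n)%nat)).
    unfold Rdiv. rewrite (Rmult_comm _ (/ _)), (Rmult_comm _ (/ _)), !Rmult_assoc.
    apply Rmult_le_compat_l; [exact P2|]. nra.
  - apply (@ex_series_scal_l R_AbsRing R_NormedModule (K' * (2 * Cmod (u N)))%R).
    apply ex_series_pos_bounded with (/ INR N)%R.
    + intros n. apply Rlt_le, Rinv_0_lt_compat, pow_lt, INR_S_pos.
    + intros n. enough (sum_n (fun n0 : nat => (/ INR (S (N + n0)) ^ 2)%R) n <= / INR N - / INR (S (N + n)))%R.
      { assert (0 <= / INR (S (N + n)))%R by apply Rlt_le, Rinv_0_lt_compat, INR_S_pos. lra. }
      induction n as [|n IH].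
      * rewrite sum_O. assert (T := tele 0%nat). rewrite Nat.add_0_r in T |- *. exact T.
      * rewrite sum_n_R_S. assert (T := tele (S n)). rewrite Nat.add_succ_r in *. lra. }
destruct Ex as [l Hl]. apply is_series_sum_n in Hl.
assert (L : Clim u (l + u N)).
(* The partial sum of the increments up to n is u (N + n + 1) - u N, hence the shift by [S N]. *)
{ assert (L' : Clim (fun n => u (n + S N)%nat) (l + u N)).
  { apply Clim_ext with (fun n => sum_n (fun n => u (S (N + n)) - u (N + n)%nat) n + u N).
    - intros n. induction n as [|n IH].
      + rewrite sum_O, Nat.add_0_r. simpl. ring.
      + rewrite sum_n_C_S. replace (u (S n + S N)%nat) with (u (S (N + S n))) by (f_equal; lia).
        transitivity ((sum_n (fun n => u (S (N + n)) - u (N + n)%nat) n + u N) + (u (S (N + S n)) - u (N + S n)%nat)); [ring|].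
        rewrite IH. replace (u (n + S N)%nat) with (u (N + S n)%nat) by (f_equal; lia). ring.
    - apply Clim_plus; [exact Hl|apply Clim_const]. }
  clear -L'. revert L'. generalize (S N) as k, (l + u N) as x. intros k x.
  rewrite !Clim_Cmod_iff. apply (is_lim_seq_incr_n (fun n => Cmod (u n - x))). }
exists (l + u N). split; [exact L|].
intros nz E. rewrite E in L. apply Clim_Cmod in L. rewrite Cmod_0 in L.
apply (is_lim_seq_incr_n _ N) in L.
assert (C0 := proj1 (Cmod_gt_0 (u N)) (nz N)).
assert (Q : Rbar_le (Cmod (u N) / 2)%R 0%R).
{ apply (is_lim_seq_le (fun _ => Cmod (u N) / 2)%R (fun n => Cmod (u (n + N)%nat)));
    [|apply is_lim_seq_const|exact L].
  intros n. rewrite Nat.add_comm. apply B. }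
simpl in Q. lra.
Qed.

(** * The complex exponential *)

Lemma sin_minus_id_le (y : R) : (Rabs y <= 1)%R -> (Rabs (sin y - y) <= y^2)%R.
Proof.
assert (P : forall y, (0 <= y <= 1)%R -> (- y^2 <= sin y - y <= 0)%R).
{ intros x [h0 h1]. destruct (pre_sin_bound x 0 h0 ltac:(lra)) as [L _].
  unfold sin_approx, sin_term in L. simpl in L.
  assert (E : (x - x^3 / 6 <= sin x)%R) by (simpl; lra).
  destruct (Rle_lt_or_eq_dec 0 x h0) as [h|<-].
  - assert (T := sin_lt_x x h). simpl in E. nra.
  - rewrite sin_0. lra. }
intros h. destruct (Rle_dec 0 y) as [h0|h0].
- rewrite Rabs_pos_eq in h by exact h0. specialize (P y ltac:(lra)).
  apply Rabs_le. nra.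
- rewrite Rabs_left in h by lra. specialize (P (-y)%R ltac:(lra)).
  rewrite sin_neg in P. apply Rabs_le. nra.
Qed.

(** From cos y = 1 - 2 sin^2 (y/2) and sin^2 x <= x^2; the latter is immediate for x > 1, where |sin
    x| <= 1 is enough. *)
Lemma cos_minus_1_le (y : R) : (Rabs (cos y - 1) <= y^2)%R.
Proof.
assert (P : (forall y, 0 <= y -> (sin y)^2 <= y^2)%R).
{ intros x h. destruct (Rle_lt_or_eq_dec 0 x h) as [h'|<-].
  - assert (T := sin_lt_x x h'). destruct (Rle_dec x 1) as [h1|h1].
    + assert (0 <= sin x)%R by (apply sin_ge_0; [lra|]; assert (Q := PI2_3_2); lra). nra.
    + assert (B := SIN_bound x). nra.
  - rewrite sin_0. lra. }
assert (P' : ((sin (y/2))^2 <= (y/2)^2)%R).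
{ destruct (Rle_dec 0 y) as [h|h]; [apply P; lra|].
  specialize (P (-(y/2))%R ltac:(lra)). rewrite sin_neg in P. nra. }
replace (cos y) with (cos (2 * (y/2)))%R by (f_equal; field).
rewrite cos_2a_sin. apply Rabs_le. nra.
Qed.

(** The inequality exp t >= 1 + t at t = -x gives exp x <= 1 / (1 - x), which is at most 1 + x + 2
    x^2 when |x| <= 1/2. *)
Lemma exp_minus_1_minus_id_le (x : R) :
  (Rabs x <= 1/2)%R -> (Rabs (exp x - 1 - x) <= 2 * x^2)%R.
Proof.
intros h. apply Rabs_le_between in h.
assert (L := exp_ineq1_le x). assert (U := exp_ineq1_le (-x)).
rewrite exp_Ropp in U.
assert (E0 := exp_pos x).
assert (U' : (exp x * (1 - x) <= 1)%R).
{ replace 1%R with (/ exp x * exp x)%R at 2 by (field; lra).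
  rewrite Rmult_comm. apply Rmult_le_compat_r; lra. }
apply Rabs_le. split; [nra|].
assert (exp x <= / (1 - x))%R.
{ apply Rmult_le_reg_r with (1 - x)%R; [lra|]. rewrite Rinv_l; lra. }
assert (/ (1 - x) <= 1 + x + 2 * x^2)%R; [|lra].
apply Rmult_le_reg_r with (1 - x)%R; [lra|]. rewrite Rinv_l by lra. nra.
Qed.

Lemma Cmod_le_Re_Im (z : C) : (Cmod z <= Rabs (Re z) + Rabs (Im z))%R.
Proof.
replace z with ((Re z : C) + Ci * (Im z : C)) at 1.
- eapply Rle_trans; [apply Cmod_triangle|].
  rewrite Cmod_mult, Cmod_Ci, !Cmod_R. lra.
- destruct z as [x y]. unfold Ci, Cplus, Cmult, RtoC. simpl. f_equal; ring.
Qed.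

Lemma im_le_Cmod (z : C) : (Rabs (Im z) <= Cmod z)%R.
Proof.
eapply Rle_trans; [|apply Rmax_Cmod]. apply Rmax_r.
Qed.

Lemma Cexp_plus (z w : C) : Cexp (z + w) = Cexp z * Cexp w.
Proof.
destruct z as [x y], w as [x' y']. unfold Cexp, Cmult, Cplus; simpl.
rewrite exp_plus, cos_plus, sin_plus. f_equal; ring.
Qed.

Lemma Cexp_0 : Cexp 0 = 1.
Proof. unfold Cexp; simpl. rewrite exp_0, cos_0, sin_0. unfold RtoC. f_equal; ring. Qed.

Lemma Cexp_neq_0 (z : C) : Cexp z <> 0.
Proof.
intros E. assert (T := Cexp_plus z (- z)). rewrite E in T.
replace (z + - z) with (RtoC 0) in T by ring. rewrite Cexp_0, Cmult_0_l in T.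
apply C1_nz. exact T.
Qed.

Lemma Cexp_opp (z : C) : Cexp (- z) = / Cexp z.
Proof.
assert (T := Cexp_plus z (- z)).
replace (z + - z) with (RtoC 0) in T by ring. rewrite Cexp_0 in T.
assert (N := Cexp_neq_0 z).
replace (Cexp (- z)) with (Cexp z * Cexp (- z) / Cexp z) by (field; exact N).
rewrite <- T. field. exact N.
Qed.

Lemma Cmod_Cexp (z : C) : Cmod (Cexp z) = exp (Re z).
Proof.
unfold Cexp, Cmod. simpl.
replace (_ + _)%R with ((exp (Re z))^2 * ((sin (Im z))² + (cos (Im z))²))%R by (unfold Rsqr; ring).
rewrite sin2_cos2, Rmult_1_r. apply sqrt_pow2, Rlt_le, exp_pos.
Qed.

(** The real and imaginary parts are split as (exp x - 1 - x) + exp x (cos y - 1) and (exp x - 1 -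
    x) y + x y + exp x (sin y - y). With exp x <= 2 they are at most 4 |w|^2 and 5 |w|^2. *)
Lemma Cexp_minus_1_minus_id_le (w : C) :
  (Cmod w <= 1/2)%R -> (Cmod (Cexp w - 1 - w) <= 10 * (Cmod w)^2)%R.
Proof.
intros h. assert (hx := re_le_Cmod w). assert (hy := im_le_Cmod w).
destruct w as [x y]. simpl in hx, hy. set (r := Cmod (x, y)) in *.
eapply Rle_trans; [apply Cmod_le_Re_Im|].
unfold Cexp. simpl.
assert (A := exp_minus_1_minus_id_le x ltac:(lra)).
assert (B := cos_minus_1_le y).
assert (S := sin_minus_id_le y ltac:(lra)).
assert (x2 : (x^2 <= r^2)%R) by (rewrite <- (pow2_abs x); apply pow_incr; split; [apply Rabs_pos|lra]).
assert (y2 : (y^2 <= r^2)%R) by (rewrite <- (pow2_abs y); apply pow_incr; split; [apply Rabs_pos|lra]).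
assert (r0 : (0 <= r)%R) by apply Cmod_ge_0.
assert (E2 : (0 < exp x <= 2)%R).
{ split; [apply exp_pos|]. apply Rabs_le_between in A.
  apply Rabs_le_between in hx.
  destruct (Rle_dec x 0) as [n|n].
  -
    assert (exp x <= exp 0)%R. { destruct (Rle_lt_or_eq_dec _ _ n) as [q| ->]; [left; now apply exp_increasing|lra]. }
    rewrite exp_0 in *. lra.
  - simpl in A. nra. }
assert (R1 : (Rabs (exp x * cos y + - (1) + - x) <= 4 * r^2)%R).
{ replace (exp x * cos y + - (1) + - x)%R with ((exp x - 1 - x) + exp x * (cos y - 1))%R by ring.
  eapply Rle_trans; [apply Rabs_triang|]. rewrite Rabs_mult, (Rabs_pos_eq (exp x)) by lra.
  assert (exp x * Rabs (cos y - 1) <= 2 * y^2)%R by (apply Rmult_le_compat; try lra; apply Rabs_pos). lra. }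
assert (R2 : (Rabs (exp x * sin y + - 0 + - y) <= 5 * r^2)%R).
{ replace (exp x * sin y + - 0 + - y)%R with ((exp x - 1 - x) * y + (x * y + exp x * (sin y - y)))%R by ring.
  eapply Rle_trans; [apply Rabs_triang|].
  assert (Q := Rabs_triang (x * y) (exp x * (sin y - y))).
  rewrite !Rabs_mult in *. rewrite (Rabs_pos_eq (exp x)) in Q by lra.
  assert (exp x * Rabs (sin y - y) <= 2 * y^2)%R by (apply Rmult_le_compat; try lra; apply Rabs_pos).
  assert (Rabs x * Rabs y <= r * r)%R by (apply Rmult_le_compat; try lra; apply Rabs_pos).
  assert (Rabs (exp x - 1 - x) * Rabs y <= (2 * r^2) * (1/2))%R by (apply Rmult_le_compat; try lra; apply Rabs_pos).
  assert (0 <= r^2)%R by nra. lra. }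
assert (0 <= r^2)%R by nra.
apply Rle_trans with (4 * r^2 + 5 * r^2)%R; [|nra].
apply Rplus_le_compat; [exact R1|].
exact R2.
Qed.

(** Both bounds are exp t >= 1 + t, at t = - ln (1 + h) and at t = ln (1 + h). *)
Lemma ln_1_plus_bounds (h : R) : (0 < h)%R -> (h - h^2 <= ln (1 + h) <= h)%R.
Proof.
intros h0. split.
- assert (T := exp_ineq1_le (- ln (1 + h))).
  rewrite exp_Ropp, exp_ln in T by lra.
  assert (/ (1 + h) <= 1 - h + h^2)%R; [|lra].
  apply Rmult_le_reg_r with (1 + h)%R; [lra|]. rewrite Rinv_l by lra. nra.
- assert (T := exp_ineq1_le (ln (1 + h))). rewrite exp_ln in T; lra.
Qed.

(** * The reciprocal Gamma function *)

Lemma is_lim_seq_inv_S : is_lim_seq (fun n => / INR (S n))%R 0%R.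
Proof.
apply (is_lim_seq_incr_1 (fun n => / INR n)%R).
replace (Finite 0) with (Rbar_inv p_infty) by reflexivity.
apply is_lim_seq_inv; [apply is_lim_seq_INR|discriminate].
Qed.

Lemma RtoC_INR_S n : RtoC (INR (S n)) = RtoC (INR n) + 1.
Proof. now rewrite S_INR, RtoC_plus. Qed.

Lemma RtoC_INR_S_neq_0 n : RtoC (INR (S n)) <> 0.
Proof. intros E. apply RtoC_inj in E. assert (T := INR_S_pos n). lra. Qed.

Lemma Cexp_ln (x : R) : (0 < x)%R -> Cexp (ln x) = x.
Proof.
intros h. unfold Cexp, RtoC; simpl. rewrite cos_0, sin_0, exp_ln by exact h.
f_equal; ring.
Qed.

Lemma Clim_div_S (z : C) : Clim (fun n => z / INR (S n)) 0.
Proof.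
apply (Clim_le _ _ (fun n => Cmod z * / INR (S n))%R).
- intros n. replace (z / INR (S n) - 0) with (z / INR (S n)) by ring.
  rewrite Cmod_div by apply RtoC_INR_S_neq_0.
  rewrite Cmod_R, Rabs_pos_eq by (left; apply INR_S_pos). unfold Rdiv; lra.
- replace (Finite 0) with (Finite (Cmod z * 0)) by (f_equal; ring).
  apply is_lim_seq_mult'; [apply is_lim_seq_const|apply is_lim_seq_inv_S].
Qed.

Lemma Clim_plus_INR_div_S (z : C) : Clim (fun n => (z + INR n) / INR (S n)) 1.
Proof.
apply Clim_ext with (fun n => 1 + (z - 1) / INR (S n)).
- intros n. assert (T := RtoC_INR_S_neq_0 n). rewrite RtoC_INR_S in *. field. exact T.
- assert (T := Clim_plus _ _ _ _ (Clim_const 1) (Clim_div_S (z - 1))).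
  rewrite Cplus_0_r in T. exact T.
Qed.

Lemma Clim_Cexp_0 (w : nat -> C) : Clim w 0 -> Clim (fun n => Cexp (w n)) 1.
Proof.
intros H. assert (H1 := proj1 (Clim_Cmod_iff _ _) H).
apply Clim_Cmod_iff.
destruct (proj2 (is_lim_seq_spec _ _) H1 (mkposreal (1/2) ltac:(lra))) as [N HN].
simpl in HN.
apply (is_lim_seq_le_le_loc (fun _ => 0%R) _ (fun n => 6 * Cmod (w n - 0))%R).
- exists N. intros n Hn. split; [apply Cmod_ge_0|]. specialize (HN n Hn).
  rewrite Rminus_0_r, Rabs_pos_eq in HN by apply Cmod_ge_0.
  replace (w n - 0) with (w n) in * by ring.
  assert (T := Cexp_minus_1_minus_id_le (w n) ltac:(lra)).
  replace (Cexp (w n) - 1) with ((Cexp (w n) - 1 - w n) + w n) by ring.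
  eapply Rle_trans; [apply Cmod_triangle|]. assert (Q := Cmod_ge_0 (w n)). nra.
- apply is_lim_seq_const.
- replace (Finite 0) with (Finite (6 * 0)) by (f_equal; ring).
  apply is_lim_seq_mult'; [apply is_lim_seq_const|exact H1].
Qed.

Lemma Clim_ln_step (z : C) :
  Clim (fun n => z * (ln (INR (S (S n))) - ln (INR (S n)))) 0.
Proof.
apply (Clim_le _ _ (fun n => Cmod z * / INR (S n))%R).
- intros n. replace (z * (ln (INR (S (S n))) - ln (INR (S n))) - 0)
    with (z * RtoC (ln (INR (S (S n))) - ln (INR (S n)))) by (rewrite RtoC_minus; ring).
  rewrite Cmod_mult, Cmod_R. apply Rmult_le_compat_l; [apply Cmod_ge_0|].
  assert (P := INR_S_pos n).
  assert (P' : (0 < / INR (S n))%R) by now apply Rinv_0_lt_compat.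
  destruct (ln_1_plus_bounds _ P') as [L U].
  replace (ln (INR (S (S n))) - ln (INR (S n)))%R with (ln (1 + / INR (S n))).
  + rewrite Rabs_pos_eq; [lra|]. rewrite <- ln_1. left. apply ln_increasing; lra.
  + replace (1 + / INR (S n))%R with (INR (S (S n)) * / INR (S n))%R
      by (rewrite (S_INR (S n)); field; lra).
    rewrite ln_mult, ln_Rinv; [lra| | |]; auto using INR_S_pos.
- replace (Finite 0) with (Finite (Cmod z * 0)) by (f_equal; ring).
  apply is_lim_seq_mult'; [apply is_lim_seq_const|apply is_lim_seq_inv_S].
Qed.

Lemma nonpos_int_factor (z : C) (n : nat) :
  ~ nonpos_int z -> z + INR n <> 0.
Proof.
intros H E. apply H. exists n.
replace z with (z + INR n - INR n) by ring. rewrite E. ring.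
Qed.

Lemma pochhammer_S (z : C) (n : nat) :
  pochhammer z (S n) = pochhammer z n * (z + INR n).
Proof. reflexivity. Qed.

Lemma pochhammer_neq_0 (z : C) (n : nat) : ~ nonpos_int z -> pochhammer z n <> 0.
Proof.
intros H. induction n as [|n IH]; simpl; [apply C1_nz|].
apply Cmult_neq_0; [exact IH|now apply nonpos_int_factor].
Qed.

(* The reciprocal of Euler's quotient, shifted so that it is defined and has
   bounded growth factor at every [n], including [n = 0]. *)
Definition Gamma_ratio (z : C) (n : nat) : C :=
  pochhammer z n / INR (fact n) * Cexp ((1 - z) * ln (INR (S n))).

Lemma RtoC_fact_neq_0 n : RtoC (INR (fact n)) <> 0.
Proof. intros E. apply RtoC_inj in E. now apply (INR_fact_neq_0 n). Qed.

Lemma RtoC_fact_S n : RtoC (INR (fact (S n))) = INR (S n) * INR (fact n).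
Proof. now rewrite fact_simpl, mult_INR, RtoC_mult. Qed.

Lemma Gamma_ratio_S (z : C) (n : nat) :
  Gamma_ratio z (S n) = Gamma_ratio z n * ((z + INR n) / INR (S n)
    * Cexp ((1 - z) * (ln (INR (S (S n))) - ln (INR (S n))))).
Proof.
unfold Gamma_ratio.
replace ((1 - z) * ln (INR (S (S n)))) with
  ((1 - z) * ln (INR (S n)) + (1 - z) * (ln (INR (S (S n))) - ln (INR (S n)))) by ring.
rewrite Cexp_plus, RtoC_fact_S. rewrite pochhammer_S.
field. split; [apply RtoC_INR_S_neq_0|apply RtoC_fact_neq_0].
Qed.

(** With w = z - 1, h = 1 / (n + 1) and L = ln (1 + h), the growth factor is (1 + w h) exp (- w L).
    Since L = h + O(h^2), the first-order terms cancel and the factor is 1 + O(h^2). *)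
Lemma Gamma_ratio_cvg (z : C) :
  exists l, Clim (Gamma_ratio z) l /\ (~ nonpos_int z -> l <> 0).
Proof.
set (w := z - 1). set (r := Cmod w).
assert (r0 : (0 <= r)%R) by apply Cmod_ge_0.
(* From this index on |w L| <= r h <= 1/2, as the exponential estimate requires. *)
destruct (INR_unbounded (2 * r)) as [N HN].
(* The three pieces of the increment, w (h - L), - w^2 h L and (1 + w h) times the remainder of the
   exponential, are at most r, r^2 and 10 r^2 (1 + r) times h^2. The constants leave some slack. *)
destruct (quadratic_product_cvg (Gamma_ratio z) (r + 12 * r^2 + 11 * r^3) N)
  as [l [Hl nz]].
- intros n Hn. rewrite Gamma_ratio_S.
  set (h := (/ INR (S n))%R). set (L := (ln (INR (S (S n))) - ln (INR (S n)))%R).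
  assert (P := INR_S_pos n).
  assert (h0 : (0 < h)%R) by now apply Rinv_0_lt_compat.
  assert (h1 : (h <= 1)%R).
  { unfold h. rewrite <- Rinv_1. apply Rinv_le_contravar; [lra|].
    rewrite S_INR. assert (T := pos_INR n). lra. }
  assert (HL : (h - h^2 <= L <= h)%R).
  { replace L with (ln (1 + h)); [now apply ln_1_plus_bounds|].
    unfold L, h.
    replace (1 + / INR (S n))%R with (INR (S (S n)) * / INR (S n))%R
      by (rewrite (S_INR (S n)); field; lra).
    rewrite ln_mult, ln_Rinv; [lra| | |]; auto using INR_S_pos. }
  assert (L0 : (0 <= L)%R) by nra.
  assert (hr : (h * r <= 1/2)%R).
  { apply Rmult_le_reg_l with (INR (S n)); [exact P|]. unfold h.
    rewrite <- Rmult_assoc, Rinv_r by lra.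
    assert (INR N <= INR n)%R by now apply le_INR. rewrite S_INR. lra. }
  assert (E1 : (1 - z) * (ln (INR (S (S n))) - ln (INR (S n))) = - w * L).
  { unfold w, L. rewrite RtoC_minus. ring. }
  assert (E2 : (z + INR n) / INR (S n) = 1 + w * h).
  { unfold w, h. rewrite RtoC_inv by lra.
    assert (T := RtoC_INR_S_neq_0 n). rewrite RtoC_INR_S in *. field. exact T. }
  rewrite E1, E2.
  assert (CL : Cmod (- w * L) = (r * L)%R).
  { rewrite Cmod_mult, Cmod_opp, Cmod_R, Rabs_pos_eq by exact L0. reflexivity. }
  assert (X := Cexp_minus_1_minus_id_le (- w * L) ltac:(rewrite CL; nra)).
  rewrite CL in X. set (e := Cexp (- w * L)) in *.
  replace (Gamma_ratio z n * ((1 + w * h) * e) - Gamma_ratio z n)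
   with ((w * RtoC (h - L) + (- (w * w * h * L)) + (1 + w * h) * (e - 1 - - w * L)) * Gamma_ratio z n)
   by (rewrite RtoC_minus; ring).
  rewrite Cmod_mult. apply Rmult_le_compat_r; [apply Cmod_ge_0|].
  replace ((r + 12 * r ^ 2 + 11 * r^3) / INR (S n) ^ 2)%R with ((r + 12 * r^2 + 11 * r^3) * h^2)%R
    by (unfold h; field; lra).
  eapply Rle_trans; [apply Cmod_triangle|].
  eapply Rle_trans; [apply Rplus_le_compat_r, Cmod_triangle|].
  rewrite Cmod_opp, !Cmod_mult, !Cmod_R. fold r.
  rewrite (Rabs_pos_eq (h - L)), (Rabs_pos_eq h), (Rabs_pos_eq L) by lra.
  assert (Y : (Cmod (1 + w * h) <= 1 + r * h)%R).
  { eapply Rle_trans; [apply Cmod_triangle|]. rewrite Cmod_1, Cmod_mult, Cmod_R.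
    rewrite (Rabs_pos_eq h) by lra. unfold r; lra. }
  assert (Z : (Cmod (1 + w * h) * Cmod (e - 1 - - w * L) <= (1 + r * 1) * (10 * (r * h)^2))%R).
  { apply Rmult_le_compat; try apply Cmod_ge_0; [nra|].
    eapply Rle_trans; [exact X|]. apply Rmult_le_compat_l; [lra|]. apply pow_incr. nra. }
  assert (r * (h - L) <= r * h^2)%R by (apply Rmult_le_compat_l; lra).
  assert (r * r * h * L <= r * r * h * h)%R.
  { apply Rmult_le_compat_l; [|lra]. apply Rmult_le_pos; nra. }
  assert (0 <= r^2 * h^2)%R by (apply Rmult_le_pos; nra).
  assert (0 <= r^3 * h^2)%R by (apply Rmult_le_pos; [apply pow_le; lra|nra]).
  nra.
- exists l. split; [exact Hl|]. intros H. apply nz. intros n.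
  unfold Gamma_ratio. apply Cmult_neq_0; [|apply Cexp_neq_0].
  apply Cmult_neq_0; [now apply pochhammer_neq_0|].
  intros E. apply C1_nz. rewrite <- (Cinv_r _ (RtoC_fact_neq_0 n)), E. ring.
Qed.

(** The right-hand side tends to 1, so the limit of Euler's quotient is the inverse of that of
    [Gamma_ratio]. The index [S n] avoids the logarithm of 0 in Euler's quotient. *)
Lemma Gamma_seq_mult_ratio (z : C) (n : nat) :
  ~ nonpos_int z ->
  Gamma_seq z (S n) * Gamma_ratio z (S n) =
  Cexp (- z * (ln (INR (S (S n))) - ln (INR (S n)))) * / ((z + INR (S n)) / INR (S (S n))).
Proof.
intros H. unfold Gamma_seq, Gamma_ratio. rewrite (pochhammer_S z (S n)).
assert (P := pochhammer_neq_0 z (S n) H). assert (P' := nonpos_int_factor z (S n) H).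
replace ((1 - z) * ln (INR (S (S n)))) with
  (ln (INR (S (S n))) + (- z * (ln (INR (S (S n))) - ln (INR (S n))) + - (z * ln (INR (S n))))) by ring.
rewrite !Cexp_plus, Cexp_opp.
replace (Cexp (ln (INR (S (S n))))) with (RtoC (INR (S (S n)))).
- assert (A := Cexp_neq_0 (z * ln (INR (S n)))). assert (B := RtoC_fact_neq_0 (S n)).
  assert (D := RtoC_INR_S_neq_0 (S n)).
  field. repeat split; assumption.
- symmetry. apply Cexp_ln, INR_S_pos.
Qed.

(** At a pole the Pochhammer symbols vanish eventually, and the conventions [Gamma z = 0] and
    [/ 0 = 0] make the limit 0 agree with [/ Gamma z]. *)
Lemma Gamma_ratio_lim (z : C) : Clim (Gamma_ratio z) (/ Gamma z).
Proof.
destruct (Classical_Prop.classic (nonpos_int z)) as [H|H].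
- rewrite Gamma_pole, Cinv_0 by exact H. destruct H as [m ->].
  apply Clim_ext_loc with (fun _ => RtoC 0) (S m); [|apply Clim_const].
  intros n Hn. unfold Gamma_ratio. rewrite pochhammer_nonpos_int by lia.
  unfold Cdiv. ring.
- destruct (Gamma_ratio_cvg z) as [l [Hl nz]]. specialize (nz H).
  replace (/ Gamma z) with l; [exact Hl|].
  rewrite (Gamma_unique z (/ l)); [field; exact nz|].
  apply (Clim_incr_1 (Gamma_seq z) (/ l)).
  replace (/ l) with (1 * / 1 * / l) by (field; exact nz).
  apply Clim_ext with (fun n => Cexp (- z * (ln (INR (S (S n))) - ln (INR (S n)))) *
     / ((z + INR (S n)) / INR (S (S n))) * / Gamma_ratio z (S n)).
  + intros n. rewrite <- Gamma_seq_mult_ratio by exact H.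
    assert (P := pochhammer_neq_0 z (S n) H).
    assert (Gamma_ratio z (S n) <> 0).
    { unfold Gamma_ratio. apply Cmult_neq_0; [|apply Cexp_neq_0].
      apply Cmult_neq_0; [exact P|].
      intros E. apply C1_nz. rewrite <- (Cinv_r _ (RtoC_fact_neq_0 (S n))), E. ring. }
    field. assumption.
  + apply Clim_mult; [apply Clim_mult|].
    * apply Clim_Cexp_0, Clim_ln_step.
    * apply Clim_inv; [apply C1_nz|].
      apply (Clim_incr_1 (fun n => (z + INR n) / INR (S n))), Clim_plus_INR_div_S.
    * apply Clim_inv; [exact nz|]. now apply (Clim_incr_1 (Gamma_ratio z)).
Qed.

Lemma Gamma_neq_0 (z : C) : ~ nonpos_int z -> Gamma z <> 0.
Proof.
intros H E. destruct (Gamma_ratio_cvg z) as [l [Hl nz]].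
apply (nz H). rewrite (Clim_unique _ _ _ Hl (Gamma_ratio_lim z)), E. apply Cinv_0.
Qed.

(** * Functional equation of the reciprocal Gamma function *)

Lemma pochhammer_S_l (z : C) (n : nat) :
  pochhammer z (S n) = z * pochhammer (z + 1) n.
Proof.
induction n as [|n IH]; [simpl; ring|].
rewrite pochhammer_S, IH, RtoC_INR_S, pochhammer_S. ring.
Qed.

(** Passing to the limit in the relation between [Gamma_ratio z (S n)] and [Gamma_ratio (z + 1) n]
    covers the poles as well, without a case distinction. *)
Lemma inv_Gamma_S (z : C) : / Gamma z = z * / Gamma (z + 1).
Proof.
apply (Clim_unique (fun n => Gamma_ratio z (S n))).
- apply (Clim_incr_1 (Gamma_ratio z)), Gamma_ratio_lim.
- replace (z * / Gamma (z + 1)) with (z * / Gamma (z + 1) * 1) by ring.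
  apply Clim_ext with (fun n => z * Gamma_ratio (z + 1) n *
     Cexp ((1 - z) * (ln (INR (S (S n))) - ln (INR (S n))))).
  + intros n. unfold Gamma_ratio.
    replace ((1 - z) * ln (INR (S (S n)))) with
      (ln (INR (S n)) + ((1 - (z + 1)) * ln (INR (S n)) + (1 - z) * (ln (INR (S (S n))) - ln (INR (S n))))) by ring.
    rewrite !Cexp_plus, pochhammer_S_l, RtoC_fact_S.
    replace (Cexp (ln (INR (S n)))) with (RtoC (INR (S n))).
    * field. split; [apply RtoC_fact_neq_0|apply RtoC_INR_S_neq_0].
    * symmetry. apply Cexp_ln, INR_S_pos.
  + apply Clim_mult; [|apply Clim_Cexp_0, Clim_ln_step].
    apply Clim_mult; [apply Clim_const|apply Gamma_ratio_lim].
Qed.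

Lemma inv_Gamma_pochhammer (z : C) (n : nat) :
  / Gamma z = pochhammer z n * / Gamma (z + INR n).
Proof.
induction n as [|n IH].
- simpl. replace (z + 0) with z by ring. ring.
- rewrite IH, (inv_Gamma_S (z + INR n)), pochhammer_S, RtoC_INR_S.
  replace (z + INR n + 1) with (z + (INR n + 1)) by ring. ring.
Qed.

Lemma nonpos_int_S (z : C) : ~ nonpos_int z -> ~ nonpos_int (z + 1).
Proof.
intros H [n E]. apply H. exists (S n).
rewrite RtoC_INR_S. replace z with (z + 1 - 1) by ring. rewrite E. ring.
Qed.

Lemma nonpos_int_plus_INR (z : C) (n : nat) :
  ~ nonpos_int z -> ~ nonpos_int (z + INR n).
Proof.
intros H [m E]. apply H. exists (m + n)%nat.
rewrite plus_INR, RtoC_plus. replace z with (z + INR n - INR n) by ring.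
rewrite E. ring.
Qed.

Lemma Re_pos_not_nonpos_int (z : C) : (0 < Re z)%R -> ~ nonpos_int z.
Proof.
intros H [n E]. rewrite E in H. simpl in H. assert (T := pos_INR n). lra.
Qed.

Lemma pochhammer_nonpos_int_eq_0 (z : C) :
  nonpos_int z -> exists N, forall n, (N <= n)%nat -> pochhammer z n = 0.
Proof.
intros [m ->]. exists (S m). intros n Hn. apply pochhammer_nonpos_int. lia.
Qed.

(** * Power growth *)

(** The growth class O(n^p). The base n + 1 lets one constant serve for all n, including n = 0. *)
Definition O_pow (u : nat -> C) (p : R) : Prop :=
  exists K, (0 < K)%R /\ forall n, (Cmod (u n) <= K * Rpower (INR (S n)) p)%R.

Lemma Rpower_pos x p : (0 < Rpower x p)%R.
Proof. apply exp_pos. Qed.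

Lemma O_pow_ext u v p : (forall n, u n = v n) -> O_pow u p -> O_pow v p.
Proof. intros E [K [K0 H]]. exists K. split; [exact K0|]. intros n. now rewrite <- E. Qed.

Lemma O_pow_mult (u v : nat -> C) (p q : R) :
  O_pow u p -> O_pow v q -> O_pow (fun n => u n * v n) (p + q).
Proof.
intros [K [K0 H]] [L [L0 G]]. exists (K * L)%R. split; [now apply Rmult_lt_0_compat|].
intros n. rewrite Cmod_mult, Rpower_plus.
replace (K * L * (Rpower (INR (S n)) p * Rpower (INR (S n)) q))%R
  with ((K * Rpower (INR (S n)) p) * (L * Rpower (INR (S n)) q))%R by ring.
apply Rmult_le_compat; auto using Cmod_ge_0.
Qed.

Lemma O_pow_weaken (u : nat -> C) (p q : R) : (p <= q)%R -> O_pow u p -> O_pow u q.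
Proof.
intros H [K [K0 HK]]. exists K. split; [exact K0|]. intros n.
eapply Rle_trans; [apply HK|]. apply Rmult_le_compat_l; [lra|].
destruct n as [|n].
- change (INR 1) with 1%R. unfold Rpower. rewrite ln_1, !Rmult_0_r. lra.
- destruct (Rle_lt_or_eq_dec _ _ H) as [h| ->]; [|lra].
  left. apply Rpower_lt; [|exact h]. rewrite S_INR. assert (T := INR_S_pos n). lra.
Qed.

Lemma O_pow_const (c : C) : O_pow (fun _ => c) 0.
Proof.
exists (Cmod c + 1)%R. assert (T := Cmod_ge_0 c). split; [lra|].
intros n. rewrite Rpower_O by apply INR_S_pos. lra.
Qed.

Lemma O_pow_scal (c : C) (u : nat -> C) (p : R) : O_pow u p -> O_pow (fun n => c * u n) p.
Proof.
intros H. assert (T := O_pow_mult _ _ _ _ (O_pow_const c) H).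
now rewrite Rplus_0_l in T.
Qed.

Lemma O_pow_INR : O_pow (fun n => INR n) 1.
Proof.
exists 1%R. split; [lra|]. intros n. rewrite Rpower_1 by apply INR_S_pos.
rewrite Cmod_R, Rabs_pos_eq by apply pos_INR. rewrite S_INR. lra.
Qed.

(** Puts terminating series under the same convergence criteria as the others, with any exponent. *)
Lemma O_pow_finite (u : nat -> C) (N : nat) (p : R) :
  (forall n, (N <= n)%nat -> u n = 0) -> O_pow u p.
Proof.
intros H.
assert (L : is_lim_seq (fun n => Cmod (u n) * Rpower (INR (S n)) (- p))%R 0%R).
{ apply is_lim_seq_ext_loc with (fun _ => 0%R); [|apply is_lim_seq_const].
  exists N. intros n Hn. rewrite H, Cmod_0 by exact Hn. ring. }
destruct (is_lim_seq_bounded _ _ L) as [K [K0 HK]].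
exists K. split; [exact K0|]. intros n.
apply Rmult_le_reg_r with (/ Rpower (INR (S n)) p)%R;
  [apply Rinv_0_lt_compat, Rpower_pos|].
rewrite Rmult_assoc, Rinv_r by (apply Rgt_not_eq, Rpower_pos).
rewrite Rmult_1_r. specialize (HK n). rewrite Rpower_Ropp in HK. exact HK.
Qed.

(** [Gamma_ratio z] is bounded because it converges, and its exponential factor has modulus (n +
    1)^(1 - Re z). *)
Lemma O_pow_pochhammer (z : C) :
  O_pow (fun n => pochhammer z n / INR (fact n)) (Re z - 1).
Proof.
destruct (Clim_bounded _ _ (Gamma_ratio_lim z)) as [M [M0 HM]].
exists M. split; [exact M0|]. intros n. specialize (HM n).
unfold Gamma_ratio in HM. rewrite Cmod_mult, Cmod_Cexp in HM.
replace (Re ((1 - z) * ln (INR (S n)))) with (- ((Re z - 1) * ln (INR (S n))))%R in HM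
  by (rewrite re_scal_r; destruct z; simpl; ring).
rewrite exp_Ropp in HM. change (exp ((Re z - 1) * ln (INR (S n)))) with
  (Rpower (INR (S n)) (Re z - 1)) in HM.
assert (P := Rpower_pos (INR (S n)) (Re z - 1)).
apply Rmult_le_compat_r with (r := Rpower (INR (S n)) (Re z - 1)) in HM; [|lra].
rewrite Rmult_assoc, Rinv_l in HM by lra. lra.
Qed.

(** Away from the poles the limit of [Gamma_ratio z] is nonzero, so the inverse sequence is bounded
    too. *)
Lemma O_pow_inv_pochhammer (z : C) : ~ nonpos_int z ->
  O_pow (fun n => INR (fact n) / pochhammer z n) (1 - Re z).
Proof.
intros H.
assert (G0 : / Gamma z <> 0).
{ intros E. apply C1_nz. rewrite <- (Cinv_r _ (Gamma_neq_0 z H)), E. ring. }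
assert (L := Clim_inv _ _ G0 (Gamma_ratio_lim z)).
destruct (Clim_bounded _ _ L) as [M [M0 HM]].
exists M. split; [exact M0|]. intros n. specialize (HM n).
assert (P := pochhammer_neq_0 z n H).
unfold Gamma_ratio in HM.
replace (/ (pochhammer z n / INR (fact n) * Cexp ((1 - z) * ln (INR (S n))))) with
  (INR (fact n) / pochhammer z n * / Cexp ((1 - z) * ln (INR (S n)))) in HM
  by (field; auto using Cexp_neq_0, RtoC_fact_neq_0).
rewrite Cmod_mult, Cmod_inv, Cmod_Cexp in HM by apply Cexp_neq_0.
replace (Re ((1 - z) * ln (INR (S n)))) with (((1 - Re z) * ln (INR (S n))))%R in HM
  by (rewrite re_scal_r; destruct z; simpl; ring).
change (exp ((1 - Re z) * ln (INR (S n)))) with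
  (Rpower (INR (S n)) (1 - Re z)) in HM.
assert (Q := Rpower_pos (INR (S n)) (1 - Re z)).
apply Rmult_le_compat_r with (r := Rpower (INR (S n)) (1 - Re z)) in HM; [|lra].
rewrite Rmult_assoc, Rinv_l in HM by lra. lra.
Qed.

(** With q = - p - 1, the terms telescope: q (x + 1)^(-q-1) <= x^(-q) - (x + 1)^(-q), which amounts
    to ((x + 1) / x)^q >= 1 + q / (x + 1). *)
Lemma ex_series_Rpower (p : R) :
  (p < -1)%R -> ex_series (fun n => Rpower (INR (S n)) p).
Proof.
intros Hp. set (q := (- p - 1)%R). assert (q0 : (0 < q)%R) by (unfold q; lra).
assert (step : forall n, (q * Rpower (INR (S (S n))) p <=
  Rpower (INR (S n)) (- q) - Rpower (INR (S (S n))) (- q))%R).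
{ intros n. set (x := INR (S n)). assert (x0 : (0 < x)%R) by apply INR_S_pos.
  rewrite S_INR. fold x.
  replace p with (- q + - (1))%R by (unfold q; ring).
  rewrite Rpower_plus, (Rpower_Ropp _ 1), Rpower_1 by lra.
  assert (E : (1 + q * / (x + 1) <= Rpower ((x + 1) / x) q)%R).
  { unfold Rpower. eapply Rle_trans; [|apply exp_ineq1_le].
    apply Rplus_le_compat_l, Rmult_le_compat_l; [lra|].
    assert (h : (0 < / x)%R) by now apply Rinv_0_lt_compat.
    assert (T := exp_ineq1_le (- ln ((x + 1) / x))).
    rewrite exp_Ropp, exp_ln in T by (apply Rdiv_lt_0_compat; lra).
    replace (/ ((x + 1) / x))%R with (1 - / (x + 1))%R in T by (field; lra). lra. }
  replace (Rpower ((x + 1) / x) q) with (Rpower (x + 1) q * Rpower x (- q))%R in E.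
  - assert (P := Rpower_pos (x + 1) (- q)).
    apply Rmult_le_compat_l with (r := Rpower (x + 1) (- q)) in E; [|lra].
    rewrite <- Rmult_assoc, <- Rpower_plus in E.
    replace (- q + q)%R with 0%R in E by ring. rewrite Rpower_O in E by lra. lra.
  - unfold Rdiv, Rpower. rewrite <- exp_plus, ln_mult, ln_Rinv by (try apply Rinv_0_lt_compat; lra).
    f_equal. ring. }
apply ex_series_incr_1.
apply ex_series_ext with (fun n => / q * (q * Rpower (INR (S (S n))) p))%R;
  [intros n; change (/ q * (q * Rpower (INR (S (S n))) p) = Rpower (INR (S (S n))) p)%R;
   field; lra|].
apply (@ex_series_scal_l R_AbsRing R_NormedModule (/ q)%R).
apply ex_series_pos_bounded with 1%R.
- intros n. apply Rmult_le_pos; [lra|left; apply Rpower_pos].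
- intros n.
  enough (sum_n (fun n0 : nat => (q * Rpower (INR (S (S n0))) p)%R) n <= 1 - Rpower (INR (S (S n))) (- q))%R
    by (assert (T := Rpower_pos (INR (S (S n))) (- q)); lra).
  induction n as [|n IH].
  + rewrite sum_O. assert (T := step 0%nat). change (INR 1) with 1%R in T.
    replace (Rpower 1 (- q)) with 1%R in T; [exact T|].
    unfold Rpower. now rewrite ln_1, Rmult_0_r, exp_0.
  + rewrite sum_n_R_S. assert (T := step (S n)). lra.
Qed.

Lemma O_pow_ex_series_Cmod (u : nat -> C) (p : R) :
  (p < -1)%R -> O_pow u p -> ex_series (fun n => Cmod (u n)).
Proof.
intros Hp [K [K0 HK]].
apply (@ex_series_le R_AbsRing R_CompleteNormedModule)
  with (fun n => K * Rpower (INR (S n)) p)%R.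
- intros n. unfold norm; simpl. unfold abs; simpl.
  rewrite Rabs_pos_eq by apply Cmod_ge_0. apply HK.
- apply (@ex_series_scal_l R_AbsRing R_NormedModule K), ex_series_Rpower, Hp.
Qed.

Lemma O_pow_ex_series (u : nat -> C) (p : R) :
  (p < -1)%R -> O_pow u p -> ex_series u.
Proof.
intros Hp H. apply ex_series_C_le with (fun n => Cmod (u n)); [intros; apply Rle_refl|].
now apply O_pow_ex_series_Cmod with p.
Qed.

Lemma O_pow_Clim_0 (u : nat -> C) (p : R) :
  (p < 0)%R -> O_pow u p -> Clim u 0.
Proof.
intros Hp [K [K0 HK]].
apply (Clim_le _ _ (fun n => K * Rpower (INR (S n)) p)%R).
- intros n. replace (u n - 0) with (u n) by ring. apply HK.
- replace (Finite 0) with (Finite (K * 0)) by (f_equal; ring).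
  apply is_lim_seq_mult'; [apply is_lim_seq_const|].
  apply (is_lim_seq_incr_1 (fun n => Rpower (INR n) p)).
  unfold Rpower.
  apply (is_lim_comp_seq exp (fun n => p * ln (INR n))%R m_infty 0%R).
  + apply is_lim_exp_m.
  + exists 0%nat. intros; discriminate.
  + replace m_infty with (Rbar_mult p p_infty).
    * apply (is_lim_seq_scal_l (fun n => ln (INR n)) p p_infty).
      apply (is_lim_comp_seq ln INR p_infty p_infty).
      -- apply is_lim_ln_p.
      -- exists 0%nat. intros; discriminate.
      -- apply is_lim_seq_INR.
    * unfold Rbar_mult; simpl. destruct Rle_dec as [h|h]; [exfalso; lra|reflexivity].
Qed.

(** * Gauss' theorem *)

Definition gauss_term (A B c : C) (k : nat) : C :=
  pochhammer A k * pochhammer B k / (INR (fact k) * pochhammer c k).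

Definition gauss_cvg (A B c : C) : Prop :=
  nonpos_int A \/ nonpos_int B \/ (0 < Re (c - A - B))%R.

Lemma gauss_term_O_pow (A B c : C) : ~ nonpos_int c ->
  O_pow (gauss_term A B c) (- Re (c - A - B) - 1).
Proof.
intros H.
apply O_pow_ext with (fun k => pochhammer A k / INR (fact k) *
  (pochhammer B k / INR (fact k)) * (INR (fact k) / pochhammer c k)).
- intros n. unfold gauss_term. field. split; [now apply pochhammer_neq_0|apply RtoC_fact_neq_0].
- replace (- Re (c - A - B) - 1)%R with ((Re A - 1) + (Re B - 1) + (1 - Re c))%R
    by (destruct A, B, c; simpl; ring).
  apply O_pow_mult; [apply O_pow_mult; apply O_pow_pochhammer|].
  now apply O_pow_inv_pochhammer.
Qed.

Lemma gauss_cvg_O_pow (A B c : C) : ~ nonpos_int c -> gauss_cvg A B c ->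
  exists p, (p < -1)%R /\ O_pow (gauss_term A B c) p.
Proof.
intros H [h|[h|h]].
- exists (-2)%R. split; [lra|]. destruct (pochhammer_nonpos_int_eq_0 _ h) as [N HN].
  apply O_pow_finite with N. intros n Hn. unfold gauss_term. rewrite HN by exact Hn.
  unfold Cdiv. ring.
- exists (-2)%R. split; [lra|]. destruct (pochhammer_nonpos_int_eq_0 _ h) as [N HN].
  apply O_pow_finite with N. intros n Hn. unfold gauss_term. rewrite HN by exact Hn.
  unfold Cdiv. ring.
- eexists. split; [|now apply gauss_term_O_pow]. lra.
Qed.

Lemma ex_series_CSeries (u : nat -> C) : ex_series u -> is_series u (CSeries u).
Proof. intros [l Hl]. now rewrite (CSeries_unique u l Hl). Qed.

Lemma gauss_term_S (A B c : C) (k : nat) : ~ nonpos_int c ->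
  gauss_term A B c (S k) * (INR (S k) * (c + INR k)) =
  gauss_term A B c k * ((A + INR k) * (B + INR k)).
Proof.
intros H. unfold gauss_term. rewrite RtoC_fact_S, !pochhammer_S. field.
repeat split; auto using RtoC_fact_neq_0, RtoC_INR_S_neq_0, pochhammer_neq_0, nonpos_int_factor.
Qed.

Lemma gauss_term_lower_S (A B c : C) (k : nat) : ~ nonpos_int c ->
  gauss_term A B (c + 1) k * (c + INR k) = gauss_term A B c k * c.
Proof.
intros H. unfold gauss_term.
assert (P := pochhammer_S_l c k). rewrite pochhammer_S in P.
assert (c <> 0) by (replace c with (c + INR 0) by (simpl; ring); now apply nonpos_int_factor).
assert (N1 := pochhammer_neq_0 _ k H).
assert (N2 := pochhammer_neq_0 _ k (nonpos_int_S _ H)).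
assert (N3 := RtoC_fact_neq_0 k).
replace (pochhammer A k * pochhammer B k / (INR (fact k) * pochhammer (c + 1) k) * (c + INR k))
  with (pochhammer A k * pochhammer B k * (pochhammer c k * (c + INR k)) /
     (INR (fact k) * pochhammer (c + 1) k * pochhammer c k)) by (field; auto).
rewrite P. field. auto.
Qed.

(* Gosper: up to a constant factor, [k t_k] is an antidifference of the summand. *)
Lemma gauss_contiguous_sum (A B c : C) (n : nat) : ~ nonpos_int c ->
  c * (c - A - B) * sum_n (gauss_term A B c) n
  - (c - A) * (c - B) * sum_n (gauss_term A B (c + 1)) n
  = - (c * (INR (S n) * gauss_term A B c (S n))).
Proof.
intros H.
assert (T : forall k, gauss_term A B (c + 1) k = gauss_term A B c k * c / (c + INR k)).
{ intros k. rewrite <- gauss_term_lower_S by exact H. field. now apply nonpos_int_factor. }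
assert (U : forall k, INR (S k) * gauss_term A B c (S k) =
   gauss_term A B c k * ((A + INR k) * (B + INR k)) / (c + INR k)).
{ intros k. rewrite <- gauss_term_S by exact H. field. now apply nonpos_int_factor. }
induction n as [|n IH].
- rewrite !sum_O, T, U. simpl INR.
  assert (Q := nonpos_int_factor c 0 H). simpl in Q. rewrite Cplus_0_r in Q. field. exact Q.
- rewrite !sum_n_C_S.
  transitivity (c * (c - A - B) * sum_n (gauss_term A B c) n
    - (c - A) * (c - B) * sum_n (gauss_term A B (c + 1)) n
    + (c * (c - A - B) * gauss_term A B c (S n) - (c - A) * (c - B) * gauss_term A B (c + 1) (S n)));
    [ring|].
  rewrite IH, (U (S n)), T. assert (Q := nonpos_int_factor c (S n) H). field. exact Q.
Qed.

(** The boundary term left by the telescoping is n t_n up to a constant, and tends to 0 because t_n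
    = O(n^p) with p < -1. *)
Lemma gauss_contiguous (A B c F0 F1 : C) : ~ nonpos_int c -> gauss_cvg A B c ->
  is_series (gauss_term A B c) F0 -> is_series (gauss_term A B (c + 1)) F1 ->
  c * (c - A - B) * F0 = (c - A) * (c - B) * F1.
Proof.
intros H Hc H0 H1.
apply Ceq_minus.
apply (Clim_unique (fun n => c * (c - A - B) * sum_n (gauss_term A B c) n
  + - ((c - A) * (c - B)) * sum_n (gauss_term A B (c + 1)) n)).
- replace (c * (c - A - B) * F0 - (c - A) * (c - B) * F1) with
   (c * (c - A - B) * F0 + - ((c - A) * (c - B)) * F1) by ring.
  apply Clim_plus; apply Clim_mult; try apply Clim_const; assumption.
- apply Clim_ext with (fun n => - c * (INR (S n) * gauss_term A B c (S n))).
  + intros n.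
    transitivity (- (c * (INR (S n) * gauss_term A B c (S n)))); [ring|].
    rewrite <- gauss_contiguous_sum by exact H. ring.
  + replace (RtoC 0) with (- c * 0) by ring.
    apply Clim_mult; [apply Clim_const|].
    apply (Clim_incr_1 (fun n => INR n * gauss_term A B c n)).
    destruct (gauss_cvg_O_pow A B c H Hc) as [p [Hp O]].
    apply O_pow_Clim_0 with (1 + p)%R; [lra|].
    apply O_pow_mult; [apply O_pow_INR|exact O].
Qed.

Lemma Cmod_pochhammer_ge (x : R) (z : C) (k : nat) :
  (0 < x <= Re z)%R -> (Cmod (pochhammer x k) <= Cmod (pochhammer z k))%R.
Proof.
intros h. induction k as [|k IH]; [simpl; lra|].
rewrite !pochhammer_S, !Cmod_mult. apply Rmult_le_compat; auto using Cmod_ge_0.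
rewrite <- RtoC_plus, Cmod_R.
assert (T := pos_INR k).
rewrite Rabs_pos_eq by lra.
assert (Q := re_le_Cmod (z + INR k)).
assert (Q' := Rle_abs (Re (z + INR k))). rewrite re_plus, re_RtoC in *. lra.
Qed.

Lemma series_near (u : nat -> C) (l a : C) (M : R) :
  is_series u l -> (forall n, (Cmod (sum_n u n - a) <= M)%R) -> (Cmod (l - a) <= M)%R.
Proof.
intros H HM.
assert (L : Clim (fun n => sum_n u n + - a) (l + - a)) by (apply Clim_plus; [exact H|apply Clim_const]).
apply Clim_Cmod in L.
apply (is_lim_seq_le _ (fun _ => M) _ M HM) in L; [exact L|apply is_lim_seq_const].
Qed.

(** Supplies the limiting value 1 as Re c grows: every term beyond the first is at most x / Re c
    times the corresponding term for the fixed real parameter x, whose absolute sum is bounded by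
    [S0]. *)
Lemma gauss_sum_near_1 (A B c F : C) (x S0 : R) :
  (0 < x <= Re c)%R ->
  is_series (gauss_term A B c) F ->
  (forall n, (sum_n (fun k => Cmod (gauss_term A B x k)) n <= S0)%R) ->
  (Cmod (F - 1) <= x / Re c * S0)%R.
Proof.
intros h HF HS. apply series_near with (1 := HF).
assert (c0 : (0 < Re c)%R) by lra.
assert (nc := Re_pos_not_nonpos_int c c0).
assert (nx : ~ nonpos_int x) by (apply Re_pos_not_nonpos_int; simpl; lra).
assert (S00 := HS 0%nat). rewrite sum_O in S00.
unfold gauss_term in S00 at 1. simpl in S00.
replace (1 * 1 / (1 * 1)) with (RtoC 1) in S00 by field. rewrite Cmod_1 in S00.
assert (xc : (0 <= x / Re c)%R) by (left; apply Rdiv_lt_0_compat; lra).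
assert (step : forall k, (Cmod (gauss_term A B c (S k)) <= x / Re c * Cmod (gauss_term A B x (S k)))%R).
{ intros k. unfold gauss_term.
  assert (N1 := pochhammer_neq_0 _ (S k) nc). assert (N2 := pochhammer_neq_0 _ (S k) nx).
  assert (N3 := RtoC_fact_neq_0 (S k)).
  rewrite !Cmod_div, !Cmod_mult by (apply Cmult_neq_0; assumption).
  (* The gain Re c / x comes from the first factor of the Pochhammer symbol alone; the others are
     compared one by one. *)
  assert (G : (Re c / x * Cmod (pochhammer x (S k)) <= Cmod (pochhammer c (S k)))%R).
  { rewrite !pochhammer_S_l, !Cmod_mult, Cmod_R, Rabs_pos_eq by lra.
    replace (Re c / x * (x * Cmod (pochhammer (x + 1) k)))%R with (Re c * Cmod (pochhammer (x + 1) k))%R by (field; lra).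
    apply Rmult_le_compat; [lra|apply Cmod_ge_0| |].
    - eapply Rle_trans; [apply Rle_abs|apply re_le_Cmod].
    - rewrite <- RtoC_plus. apply Cmod_pochhammer_ge. destruct c; simpl in *. lra. }
  apply Cmod_gt_0 in N1, N2, N3.
  assert (A0 := Cmod_ge_0 (pochhammer A (S k))). assert (B0 := Cmod_ge_0 (pochhammer B (S k))).
  set (f := Cmod (INR (fact (S k)))) in *. set (pc := Cmod (pochhammer c (S k))) in *.
  set (px := Cmod (pochhammer x (S k))) in *. set (pA := Cmod (pochhammer A (S k))) in *.
  set (pB := Cmod (pochhammer B (S k))) in *.
  replace (x / Re c * (pA * pB / (f * px)))%R with (pA * pB * / (f * (Re c / x * px)))%R by (field; lra).
  unfold Rdiv at 1. apply Rmult_le_compat_l; [now apply Rmult_le_pos|].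
  apply Rinv_le_contravar; [|apply Rmult_le_compat_l; lra].
  apply Rmult_lt_0_compat; [lra|]. apply Rmult_lt_0_compat; [apply Rdiv_lt_0_compat|]; lra. }
assert (E : forall n, (Cmod (sum_n (gauss_term A B c) n - 1) <=
   x / Re c * sum_n (fun k => Cmod (gauss_term A B x k)) n)%R).
{ induction n as [|n IH].
  - rewrite !sum_O. unfold gauss_term at 1 2. simpl.
    replace (1 * 1 / (1 * 1) - 1) with (RtoC 0) by field.
    replace (1 * 1 / (1 * 1)) with (RtoC 1) by field. rewrite Cmod_0, Cmod_1. lra.
  - rewrite sum_n_C_S, sum_n_R_S.
    replace (sum_n (gauss_term A B c) n + gauss_term A B c (S n) - 1) with
      ((sum_n (gauss_term A B c) n - 1) + gauss_term A B c (S n)) by ring.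
    eapply Rle_trans; [apply Cmod_triangle|]. specialize (step n). lra. }
intros n. eapply Rle_trans; [apply E|]. apply Rmult_le_compat_l; [exact xc|apply HS].
Qed.

Lemma ex_series_pos_sum_le (v : nat -> R) :
  (forall n, (0 <= v n)%R) -> ex_series v -> exists M, forall n, (sum_n v n <= M)%R.
Proof.
intros H [l Hl]. exists l. intros n.
apply (is_lim_seq_incr_compare (sum_n v) l Hl).
intros k. rewrite sum_n_R_S. specialize (H (S k)). lra.
Qed.

(** Iterating the contiguous relation expresses the sum at c through the sum at c + N, which tends
    to 1. The Pochhammer quotients that accumulate turn into Gamma values in the limit. The
    reciprocal form also covers terminating series whose excess c - A - B is a pole. *)
Lemma gauss_summation (A B c : C) : ~ nonpos_int c -> gauss_cvg A B c ->
  exists F, is_series (gauss_term A B c) F /\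
    / Gamma c * / Gamma (c - A - B) * F = / Gamma (c - A) * / Gamma (c - B).
Proof.
intros H Hc.
assert (nN : forall N, ~ nonpos_int (c + INR N)) by (intros; now apply nonpos_int_plus_INR).
assert (cN : forall N, gauss_cvg A B (c + INR N)).
{ intros N. destruct Hc as [h|[h|h]]; [now left|right; now left|right; right].
  assert (T := pos_INR N). destruct A, B, c; simpl in *. lra. }
set (F := fun N => CSeries (gauss_term A B (c + INR N))).
assert (HF : forall N, is_series (gauss_term A B (c + INR N)) (F N)).
{ intros N. apply ex_series_CSeries.
  destruct (gauss_cvg_O_pow A B _ (nN N) (cN N)) as [p [Hp O]].
  now apply O_pow_ex_series with p. }
exists (F 0%nat). split.
{ assert (T := HF 0%nat). simpl INR in T. replace (c + 0) with c in T by ring. exact T. }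
assert (E : forall N, pochhammer c N * pochhammer (c - A - B) N * F 0%nat =
   pochhammer (c - A) N * pochhammer (c - B) N * F N).
{ induction N as [|N IH]; [simpl; ring|].
  rewrite !pochhammer_S.
  assert (G := gauss_contiguous A B (c + INR N) (F N) (F (S N)) (nN N) (cN N) (HF N)).
  replace (c + INR N + 1) with (c + INR (S N)) in G by (rewrite RtoC_INR_S; ring).
  specialize (G (HF (S N))).
  transitivity ((pochhammer c N * pochhammer (c - A - B) N * F 0%nat) * ((c + INR N) * (c - A - B + INR N))); [ring|].
  rewrite IH.
  transitivity ((pochhammer (c - A) N * pochhammer (c - B) N) * ((c + INR N) * (c + INR N - A - B) * F N)); [ring|].
  rewrite G. ring. }
assert (L : Clim F 1).
(* N0 is so large that x = Re c + N0 is at least 1 and that the series with lower parameter x has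
   positive excess, hence converges absolutely. *)
{ destruct (INR_unbounded (Rabs (Re c) + Rabs (Re (c - A - B)) + 1)) as [N0 HN0].
  set (x := (Re c + INR N0)%R).
  assert (x1 : (1 <= x)%R).
  { unfold x. assert (T := Rle_abs (- Re c)). rewrite Rabs_Ropp in T.
    assert (T' := Rabs_pos (Re (c - A - B))). lra. }
  assert (nx : ~ nonpos_int x) by (apply Re_pos_not_nonpos_int; simpl; lra).
  assert (ex : ex_series (fun k => Cmod (gauss_term A B x k))).
  { apply O_pow_ex_series_Cmod with (- Re (x - A - B) - 1)%R; [|now apply gauss_term_O_pow].
    assert (T := Rle_abs (- Re (c - A - B))). rewrite Rabs_Ropp in T.
    assert (T' := Rabs_pos (Re c)). unfold x.
    destruct A, B, c; simpl in *. lra. }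
  destruct (ex_series_pos_sum_le _ (fun n => Cmod_ge_0 _) ex) as [S0 HS].
  apply Clim_Cmod_iff. apply (is_lim_seq_incr_n _ N0).
  apply (is_lim_seq_le_le (fun _ => 0%R) _ (fun n => x * Rabs S0 * / INR (S n))%R).
  - intros n. split; [apply Cmod_ge_0|].
    assert (Rc : Re (c + INR (n + N0)) = (x + INR n)%R).
    { unfold x. rewrite plus_INR. destruct c; simpl; ring. }
    assert (Pn := pos_INR n).
    assert (B1 := gauss_sum_near_1 A B (c + INR (n + N0)) _ x S0 ltac:(rewrite Rc; lra) (HF _) HS).
    eapply Rle_trans; [exact B1|]. rewrite Rc.
    unfold Rdiv. rewrite !Rmult_assoc. apply Rmult_le_compat_l; [lra|].
    rewrite (Rmult_comm (Rabs S0)).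
    apply Rle_trans with (/ (x + INR n) * Rabs S0)%R.
    + apply Rmult_le_compat_l; [left; apply Rinv_0_lt_compat; lra|apply Rle_abs].
    + apply Rmult_le_compat_r; [apply Rabs_pos|]. apply Rinv_le_contravar; [apply INR_S_pos|].
      rewrite S_INR. lra.
  - apply is_lim_seq_const.
  - replace (Finite 0) with (Finite (x * Rabs S0 * 0)) by (f_equal; ring).
    apply is_lim_seq_mult'; [apply is_lim_seq_const|apply is_lim_seq_inv_S]. }
apply (Clim_unique (fun n => Gamma_ratio c n * Gamma_ratio (c - A - B) n * F 0%nat)).
- apply Clim_mult; [apply Clim_mult; apply Gamma_ratio_lim|apply Clim_const].
- apply Clim_ext with (fun n => Gamma_ratio (c - A) n * Gamma_ratio (c - B) n * F n).
  + intros n. unfold Gamma_ratio.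
    set (f := RtoC (INR (fact n))). assert (f0 : f <> 0) by apply RtoC_fact_neq_0.
    set (l := RtoC (ln (INR (S n)))).
    transitivity ((pochhammer (c - A) n * pochhammer (c - B) n * F n) / (f * f)
      * (Cexp ((1 - (c - A)) * l) * Cexp ((1 - (c - B)) * l))); [field; exact f0|].
    (* The powers of n + 1 match because (c - A) + (c - B) = c + (c - A - B). *)
    rewrite <- E, <- Cexp_plus.
    replace ((1 - (c - A)) * l + (1 - (c - B)) * l) with ((1 - c) * l + (1 - (c - A - B)) * l) by ring.
    rewrite Cexp_plus. field. exact f0.
  + rewrite <- (Cmult_1_r (/ Gamma (c - A) * / Gamma (c - B))).
    apply Clim_mult; [apply Clim_mult; apply Gamma_ratio_lim|exact L].
Qed.

Lemma Cminus_0_r (x : C) : x - 0 = x.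
Proof. ring. Qed.

Lemma Cminus_plus (x y : C) : x - y + y = x.
Proof. ring. Qed.

(** * Interchange of summations *)

Lemma is_series_Cmult_l (k : C) (u : nat -> C) (l : C) :
  is_series u l -> is_series (fun n => k * u n) (k * l).
Proof. apply (is_series_scal k u l). Qed.

Lemma is_lim_seq_sum_n_0 (d : nat -> nat -> R) (N : nat) :
  (forall n, is_lim_seq (fun M => d M n) 0%R) ->
  is_lim_seq (fun M => sum_n (d M) N) 0%R.
Proof.
intros H. induction N as [|N IH].
- apply is_lim_seq_ext with (fun M => d M 0%nat); [intros; now rewrite sum_O|apply H].
- apply is_lim_seq_ext with (fun M => sum_n (d M) N + d M (S N))%R;
    [intros; now rewrite sum_n_R_S|].
  replace (Finite 0) with (Finite (0 + 0)) by (f_equal; ring).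
  now apply is_lim_seq_plus'.
Qed.

Lemma sum_n_R_nonneg (v : nat -> R) n : (forall k, (0 <= v k)%R) -> (0 <= sum_n v n)%R.
Proof.
intros H. induction n as [|n IH]; [rewrite sum_O; apply H|].
rewrite sum_n_R_S. specialize (H (S n)). lra.
Qed.

(** Dominated convergence where M is both the parameter and the length of the sum: beyond some N the
    tail is controlled by that of g, and the first N terms tend to 0 individually. *)
Lemma tannery_0 (d : nat -> nat -> R) (g : nat -> R) :
  (forall M n, (0 <= d M n <= g n)%R) -> ex_series g ->
  (forall n, is_lim_seq (fun M => d M n) 0%R) ->
  is_lim_seq (fun M => sum_n (d M) M) 0%R.
Proof.
intros Hd [l Hl] H0. apply is_lim_seq_spec. intros eps.
assert (e2 : (0 < eps / 2)%R) by (assert (T := cond_pos eps); lra).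
assert (Hl' := proj2 (is_lim_seq_spec (sum_n g) l) Hl (mkposreal _ e2)). simpl in Hl'.
destruct Hl' as [N HN].
assert (inc : forall n, (sum_n g n <= l)%R).
{ apply (is_lim_seq_incr_compare (sum_n g) l Hl).
  intros n. rewrite sum_n_R_S. destruct (Hd 0%nat (S n)). lra. }
destruct (proj2 (is_lim_seq_spec _ _) (is_lim_seq_sum_n_0 d N H0) (mkposreal _ e2)) as [N1 HN1].
simpl in HN1.
exists (N + N1)%nat. intros M HM.
assert (p : forall K, (0 <= sum_n (d M) K)%R) by (intros; apply sum_n_R_nonneg; intros; apply Hd).
specialize (HN1 M ltac:(lia)). rewrite Rminus_0_r, Rabs_pos_eq in * by apply p.
specialize (HN N ltac:(lia)). apply Rabs_lt_between in HN.
enough (E : forall k, (sum_n (d M) (N + k) <= sum_n (d M) N + (sum_n g (N + k) - sum_n g N))%R).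
{ specialize (E (M - N)%nat). replace (N + (M - N))%nat with M in E by lia.
  specialize (inc M). lra. }
induction k as [|k IH]; [rewrite Nat.add_0_r; lra|].
rewrite Nat.add_succ_r, !sum_n_R_S. destruct (Hd M (S (N + k))). lra.
Qed.

Lemma Cmod_sum_n_minus_le (u v : nat -> C) n :
  (Cmod (sum_n u n - sum_n v n) <= sum_n (fun k => Cmod (u k - v k)) n)%R.
Proof.
induction n as [|n IH]; [rewrite !sum_O; apply Rle_refl|].
rewrite !sum_n_C_S, sum_n_R_S.
replace (sum_n u n + u (S n) - (sum_n v n + v (S n))) with
  ((sum_n u n - sum_n v n) + (u (S n) - v (S n))) by ring.
eapply Rle_trans; [apply Cmod_triangle|lra].
Qed.

Lemma sum_n_extend_0 (u : nat -> C) (m M : nat) :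
  (m <= M)%nat -> (forall n, (m < n)%nat -> u n = 0) -> sum_n u M = sum_n u m.
Proof.
intros h H. induction h as [|M h IH]; [reflexivity|].
rewrite sum_n_C_S, IH, H by lia. apply Cplus_0_r.
Qed.

(** Because f vanishes for m < n, the first M column sums add up to the sum over the square n, m <=
    M, which is also the sum of the first M rows truncated at M. The truncation errors are dominated
    by 2 G n and disappear by [tannery_0]. *)
Lemma triangular_fubini (f : nat -> nat -> C) (G : nat -> R) (r : nat -> C) :
  (forall n m, (m < n)%nat -> f n m = 0) ->
  (forall n M, (sum_n (fun m => Cmod (f n m)) M <= G n)%R) ->
  ex_series G ->
  (forall n, is_series (f n) (r n)) ->
  exists l, is_series r l /\ is_series (fun m => sum_n (fun n => f n m) m) l.
Proof.
intros f0 HG exG Hr.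
assert (near : forall n M, (Cmod (sum_n (f n) M) <= G n)%R)
  by (intros; eapply Rle_trans; [apply Cmod_sum_n_le|apply HG]).
assert (rG : forall n, (Cmod (r n) <= G n)%R).
{ intros n. rewrite <- (Cminus_0_r (r n)). apply series_near with (1 := Hr n).
  intros M. rewrite Cminus_0_r. apply near. }
destruct (ex_series_C_le r G rG exG) as [l Hl].
exists l. split; [exact Hl|].
apply is_series_sum_n.
apply Clim_ext with (fun M => (sum_n (fun n => sum_n (f n) M) M - sum_n r M) + sum_n r M).
- intros M. transitivity (sum_n (fun n => sum_n (f n) M) M); [apply Cminus_plus|].
  rewrite sum_n_switch. apply sum_n_ext_loc. intros m hm.
  apply sum_n_extend_0; auto.
- rewrite <- (Cplus_0_l l). apply Clim_plus; [|exact Hl].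
  apply (Clim_le _ _ (fun M => sum_n (fun n => Cmod (sum_n (f n) M - r n)) M)).
  + intros M. rewrite Cminus_0_r.
    apply Cmod_sum_n_minus_le.
  + apply (tannery_0 (fun M n => Cmod (sum_n (f n) M - r n)) (fun n => 2 * G n)%R).
    * intros M n. split; [apply Cmod_ge_0|].
      assert (T := Cmod_triangle (sum_n (f n) M) (- r n)). rewrite Cmod_opp in T.
      specialize (near n M). specialize (rG n). unfold Cminus. lra.
    * apply (@ex_series_scal_l R_AbsRing R_NormedModule 2%R), exG.
    * intros n. apply Clim_Cmod_iff, Hr.
Qed.

Lemma is_series_shift_0 (u : nat -> C) (n : nat) (l : C) :
  (forall m, (m < n)%nat -> u m = 0) -> is_series (fun k => u (n + k)%nat) l ->
  is_series u l.
Proof.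
intros H Hs. destruct n as [|n]; [exact Hs|].
apply is_series_decr_n with (S n); [lia|]. simpl pred.
assert (E : forall k, (k <= n)%nat -> sum_n u k = RtoC 0).
{ induction k as [|k IH]; intros hk; [rewrite sum_O; apply H; lia|].
  rewrite sum_n_C_S, IH, H by lia. apply Cplus_0_r. }
specialize (E n (le_n n)).
assert (E' : plus l (opp (sum_n u n)) = l).
{ change (l + - sum_n u n = l). rewrite E. ring. }
rewrite <- E' in Hs. exact Hs.
Qed.

(** * Dixon's theorem *)

(** The kernel of a Bailey pair relative to a, in the limit q -> 1. The guard is needed because
    subtraction on naturals truncates. *)
Definition bailey_kernel (a : C) (n m : nat) : C :=
  if (n <=? m)%nat then / (INR (fact (m - n)) * pochhammer (1 + a) (m + n)) else 0.

Lemma bailey_kernel_lt (a : C) (n m : nat) : (m < n)%nat -> bailey_kernel a n m = 0.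
Proof. intros h. unfold bailey_kernel. now rewrite (proj2 (Nat.leb_gt n m) h). Qed.

Lemma bailey_kernel_plus (a : C) (n k : nat) :
  bailey_kernel a n (n + k) = / (INR (fact k) * pochhammer (1 + a) (n + k + n)).
Proof.
unfold bailey_kernel. rewrite (proj2 (Nat.leb_le n (n + k))) by lia.
now replace (n + k - n)%nat with k by lia.
Qed.

(** The sign is the one in 1 / (m - n)! = (-1)^n (-m)_n / m!: multiplied by the kernel,
    [bailey_alpha] is, up to a factor depending on m, the summand of the well-poised 3F2(1) with
    parameters a, c, -m. *)
Definition bailey_alpha (a c : C) (n : nat) : C :=
  (-1)^n * pochhammer a n * pochhammer c n / (INR (fact n) * pochhammer (1 + a - c) n).

Lemma bailey_alpha_S (a c : C) (n : nat) : ~ nonpos_int (1 + a - c) ->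
  bailey_alpha a c (S n) * (INR (S n) * (1 + a - c + INR n)) =
  - (bailey_alpha a c n * ((a + INR n) * (c + INR n))).
Proof.
intros H. unfold bailey_alpha. rewrite RtoC_fact_S, !pochhammer_S.
change ((-1)^(S n)) with (-1 * (-1)^n). field.
repeat split; auto using RtoC_fact_neq_0, RtoC_INR_S_neq_0, pochhammer_neq_0, nonpos_int_factor.
Qed.

(** The case n = S m, where both sides vanish, is included so that the sums for m and m + 1 can be
    compared over the same range. *)
Lemma bailey_kernel_pred (a : C) (n m : nat) : ~ nonpos_int (1 + a) -> (n <= S m)%nat ->
  bailey_kernel a n m =
  bailey_kernel a n (S m) * ((INR (S m) - INR n) * (1 + a + INR (m + n))).
Proof.
intros H h. destruct (Nat.eq_dec n (S m)) as [->|ne].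
- rewrite bailey_kernel_lt by lia. ring.
- replace m with (n + (m - n))%nat by lia. set (k := (m - n)%nat).
  replace (S (n + k)) with (n + S k)%nat by lia.
  rewrite !bailey_kernel_plus.
  replace (n + S k + n)%nat with (S (n + k + n)) by lia.
  rewrite RtoC_fact_S, pochhammer_S, (plus_INR n (S k)), RtoC_plus. field.
  repeat split; auto using RtoC_fact_neq_0, RtoC_INR_S_neq_0, pochhammer_neq_0, nonpos_int_factor.
Qed.

Lemma bailey_kernel_succ (a : C) (n m : nat) : ~ nonpos_int (1 + a) -> (n <= m)%nat ->
  bailey_kernel a (S n) m * (1 + a + INR (m + n)) =
  bailey_kernel a n m * (INR m - INR n).
Proof.
intros H h. destruct (Nat.eq_dec n m) as [->|ne].
- rewrite bailey_kernel_lt by lia. ring.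
- replace m with (S n + (m - S n))%nat by lia. set (k := (m - S n)%nat).
  rewrite bailey_kernel_plus. replace (S n + k)%nat with (n + S k)%nat by lia.
  rewrite !bailey_kernel_plus.
  replace (n + S k + S n)%nat with (S (n + S k + n)) by lia.
  rewrite RtoC_fact_S, pochhammer_S, (plus_INR n (S k)), RtoC_plus. field.
  repeat split; auto using RtoC_fact_neq_0, RtoC_INR_S_neq_0, pochhammer_neq_0, nonpos_int_factor.
Qed.

(* Zeilberger's recurrence, with certificate [- n (a - c + n) (1 + a + m + n) / 2]
   times the summand at [m + 1]. *)
Lemma dixon_recurrence (a c : C) (m : nat) :
  ~ nonpos_int (1 + a) -> ~ nonpos_int (1 + a - c) ->
  INR (S m) * (1 + a / 2 + INR m) * (1 + a - c + INR m)
    * sum_n (fun n => bailey_alpha a c n * bailey_kernel a n (S m)) (S m) =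
  (1 + a / 2 - c + INR m)
    * sum_n (fun n => bailey_alpha a c n * bailey_kernel a n m) m.
Proof.
intros Ha Hc.
set (x := fun m n => bailey_alpha a c n * bailey_kernel a n m).
change (INR (S m) * (1 + a / 2 + INR m) * (1 + a - c + INR m) * sum_n (x (S m)) (S m)
  = (1 + a / 2 - c + INR m) * sum_n (x m) m).
assert (R1 : forall n, (n <= S m)%nat ->
   x m n = x (S m) n * ((INR (S m) - INR n) * (1 + a + INR m + INR n))).
{ intros n h. unfold x. rewrite (bailey_kernel_pred a n m Ha h), plus_INR, RtoC_plus. ring. }
assert (R2 : forall n, (n <= m)%nat ->
   x (S m) (S n) * (INR (S n) * (1 + a - c + INR n) * (1 + a + INR (S m) + INR n)) =
   - (x (S m) n * ((a + INR n) * (c + INR n) * (INR (S m) - INR n)))).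
{ intros n h. unfold x.
  assert (K := bailey_kernel_succ a n (S m) Ha ltac:(lia)).
  rewrite plus_INR, RtoC_plus in K.
  transitivity ((bailey_alpha a c (S n) * (INR (S n) * (1 + a - c + INR n))) *
    (bailey_kernel a (S n) (S m) * (1 + a + (INR (S m) + INR n)))); [ring|].
  rewrite K, bailey_alpha_S by exact Hc. ring. }
replace (sum_n (x m) m) with (sum_n (x m) (S m)).
2:{ apply sum_n_extend_0; [lia|]. intros n hn. unfold x. rewrite bailey_kernel_lt by exact hn. ring. }
(* The telescoped form for partial sums. The factor S m - N kills the boundary term at N = S m. *)
assert (E : forall N, (N <= S m)%nat ->
  INR (S m) * (1 + a / 2 + INR m) * (1 + a - c + INR m) * sum_n (x (S m)) N
  - (1 + a / 2 - c + INR m) * sum_n (x m) N =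
  1/2 * (a + INR N) * (c + INR N) * (INR (S m) - INR N) * x (S m) N).
{ induction N as [|N IH]; intros h.
  - rewrite !sum_O, R1 by lia. simpl (INR 0). rewrite !RtoC_INR_S. field.
  - rewrite !sum_n_C_S, (R1 (S N)) by exact h.
    assert (R := R2 N ltac:(lia)). specialize (IH ltac:(lia)).
    transitivity ((INR (S m) * (1 + a / 2 + INR m) * (1 + a - c + INR m) * sum_n (x (S m)) N
      - (1 + a / 2 - c + INR m) * sum_n (x m) N)
      + (INR (S m) * (1 + a / 2 + INR m) * (1 + a - c + INR m) * x (S m) (S N)
      - (1 + a / 2 - c + INR m) * (x (S m) (S N) * ((INR (S m) - INR (S N)) * (1 + a + INR m + INR (S N)))))).
    { ring. }
    rewrite IH.
    transitivity (- (1/2) * - (x (S m) N * ((a + INR N) * (c + INR N) * (INR (S m) - INR N)))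
      + (INR (S m) * (1 + a / 2 + INR m) * (1 + a - c + INR m) * x (S m) (S N)
      - (1 + a / 2 - c + INR m) * (x (S m) (S N) * ((INR (S m) - INR (S N)) * (1 + a + INR m + INR (S N)))))).
    { field. }
    rewrite <- R, !RtoC_INR_S. field. }
specialize (E (S m) (le_n _)).
apply Ceq_minus. rewrite E. ring.
Qed.

Lemma half_not_nonpos_int (a : C) : ~ nonpos_int (1 + a) -> ~ nonpos_int (1 + a / 2).
Proof.
intros H [n E]. apply H. exists (S (n + n)).
rewrite RtoC_INR_S, plus_INR, RtoC_plus.
replace a with (2 * (1 + a / 2) - 2) by field. rewrite E. ring.
Qed.

(** Terminating Dixon: the recurrence is of first order in m, so its solution is a product of
    Pochhammer symbols. In Bailey's lemma these values form the sequence beta. *)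
Lemma dixon_sum (a c : C) (m : nat) :
  ~ nonpos_int (1 + a) -> ~ nonpos_int (1 + a - c) ->
  sum_n (fun n => bailey_alpha a c n * bailey_kernel a n m) m =
  pochhammer (1 + a / 2 - c) m
    / (INR (fact m) * pochhammer (1 + a / 2) m * pochhammer (1 + a - c) m).
Proof.
intros Ha Hc. assert (Hh := half_not_nonpos_int a Ha).
induction m as [|m IH].
- rewrite sum_O. unfold bailey_alpha. rewrite (bailey_kernel_plus a 0 0 : bailey_kernel a 0 0 = _). simpl.
  C_eq. field.
- assert (R := dixon_recurrence a c m Ha Hc). rewrite IH in R.
  rewrite RtoC_fact_S, !pochhammer_S.
  assert (N1 := RtoC_INR_S_neq_0 m). assert (N2 := nonpos_int_factor _ m Hh).
  assert (N3 := nonpos_int_factor _ m Hc).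
  assert (M1 := RtoC_fact_neq_0 m). assert (M2 := pochhammer_neq_0 _ m Hh).
  assert (M3 := pochhammer_neq_0 _ m Hc).
  set (h := 1 + a / 2) in *.
  assert (X : forall y p q : C, p <> 0 -> p * y = q -> y = q / p).
  { intros y p q Hp <-. field. exact Hp. }
  rewrite (X _ _ _ (Cmult_neq_0 _ _ (Cmult_neq_0 _ _ N1 N2) N3) R).
  C_eq.
  field. repeat split; assumption.
Qed.

Lemma pochhammer_plus (z : C) (n k : nat) :
  pochhammer z (n + k) = pochhammer z n * pochhammer (z + INR n) k.
Proof.
induction k as [|k IH].
- rewrite Nat.add_0_r. simpl. ring.
- rewrite Nat.add_succ_r, !pochhammer_S, IH, plus_INR, RtoC_plus. ring.
Qed.

Lemma pochhammer_1 (n : nat) : pochhammer 1 n = INR (fact n).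
Proof.
induction n as [|n IH]; [reflexivity|].
rewrite pochhammer_S, IH, RtoC_fact_S, RtoC_INR_S. ring.
Qed.

(** * The well-poised transformation *)

(** The sequence delta of Bailey's lemma; [bailey_row_sum] computes its conjugate gamma. *)
Definition bailey_delta (d e : C) (m : nat) : C := pochhammer d m * pochhammer e m.

Lemma bailey_delta_eq_0 (d e : C) : nonpos_int d \/ nonpos_int e ->
  exists N, forall m, (N <= m)%nat -> bailey_delta d e m = 0.
Proof.
intros [h|h]; destruct (pochhammer_nonpos_int_eq_0 _ h) as [N HN];
  exists N; intros m hm; unfold bailey_delta; rewrite HN by exact hm; ring.
Qed.

Lemma nonpos_int_shift (d : C) (n : nat) :
  nonpos_int d -> pochhammer d n <> 0 -> nonpos_int (d + INR n).
Proof.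
intros [N ->] h. destruct (Nat.le_gt_cases n N) as [hn|hn].
- exists (N - n)%nat. rewrite minus_INR, RtoC_minus by exact hn. ring.
- exfalso. apply h, pochhammer_nonpos_int, hn.
Qed.

(** From m = n on, the row is a Gauss series with parameters d + n, e + n and 1 + a + 2n, whose
    excess is 1 + a - d - e for every n. *)
Lemma bailey_row_sum (a d e : C) (n : nat) :
  ~ nonpos_int (1 + a) -> ~ nonpos_int (1 + a - d) -> ~ nonpos_int (1 + a - e) ->
  gauss_cvg d e (1 + a) ->
  exists g, is_series (fun m => bailey_kernel a n m * bailey_delta d e m) g /\
    / Gamma (1 + a) * / Gamma (1 + a - d - e) * g =
    / Gamma (1 + a - d) * / Gamma (1 + a - e) *
      (bailey_delta d e n / (pochhammer (1 + a - d) n * pochhammer (1 + a - e) n)).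
Proof.
intros Ha Hd He Hc.
(* If the series terminates before index n, then d + n or e + n is a positive integer and the
   shifted Gauss series need not converge; but then the row is identically zero. *)
destruct (Classical_Prop.classic (bailey_delta d e n = 0)) as [Z|Z].
- exists (RtoC 0). split.
  + apply is_series_shift_0 with n.
    * intros m hm. rewrite bailey_kernel_lt by exact hm. ring.
    * apply is_series_ext with (fun k => RtoC 0).
      -- intros k. unfold bailey_delta in *. rewrite !pochhammer_plus.
         C_eq.
         transitivity (bailey_kernel a n (n + k) * ((pochhammer d n * pochhammer e n) *
           (pochhammer (d + INR n) k * pochhammer (e + INR n) k))); [rewrite Z|]; ring.
      -- apply is_series_sum_n. apply Clim_ext with (fun _ => RtoC 0); [|apply Clim_const].
         intros k. induction k as [|k IH]; [now rewrite sum_O|].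
         rewrite sum_n_C_S, <- IH. symmetry. apply Cplus_0_r.
  + rewrite Z. unfold Cdiv. ring.
- assert (Zd : pochhammer d n <> 0) by (intros E; apply Z; unfold bailey_delta; rewrite E; ring).
  assert (Ze : pochhammer e n <> 0) by (intros E; apply Z; unfold bailey_delta; rewrite E; ring).
  assert (Ha2 := nonpos_int_plus_INR _ (n + n) Ha).
  destruct (gauss_summation (d + INR n) (e + INR n) (1 + a + INR (n + n)) Ha2) as [F [HF EF]].
  + destruct Hc as [h|[h|h]].
    * left. now apply nonpos_int_shift.
    * right; left. now apply nonpos_int_shift.
    * right; right. rewrite plus_INR. destruct a, d, e; simpl in *. lra.
  + exists (bailey_delta d e n / pochhammer (1 + a) (n + n) * F). split.
    * apply is_series_shift_0 with n.
      -- intros m hm. rewrite bailey_kernel_lt by exact hm. ring.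
      -- apply is_series_ext with (fun k => bailey_delta d e n / pochhammer (1 + a) (n + n) *
           gauss_term (d + INR n) (e + INR n) (1 + a + INR (n + n)) k).
         ++ intros k. rewrite bailey_kernel_plus. unfold bailey_delta, gauss_term.
            replace (n + k + n)%nat with (n + n + k)%nat by lia.
            rewrite (pochhammer_plus d), (pochhammer_plus e), (pochhammer_plus (1 + a) (n + n) k).
            C_eq.
            field. repeat split; auto using RtoC_fact_neq_0, pochhammer_neq_0.
         ++ now apply is_series_Cmult_l.
    * replace (1 + a + INR (n + n) - (d + INR n) - (e + INR n)) with (1 + a - d - e) in EF
        by (rewrite plus_INR, RtoC_plus; ring).
      replace (1 + a + INR (n + n) - (d + INR n)) with (1 + a - d + INR n) in EF
        by (rewrite plus_INR, RtoC_plus; ring).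
      replace (1 + a + INR (n + n) - (e + INR n)) with (1 + a - e + INR n) in EF
        by (rewrite plus_INR, RtoC_plus; ring).
      rewrite (inv_Gamma_pochhammer (1 + a) (n + n)),
        (inv_Gamma_pochhammer (1 + a - d) n), (inv_Gamma_pochhammer (1 + a - e) n).
      assert (N1 := pochhammer_neq_0 _ (n + n) Ha).
      assert (N2 := pochhammer_neq_0 _ n Hd). assert (N3 := pochhammer_neq_0 _ n He).
      transitivity (bailey_delta d e n *
        (/ Gamma (1 + a + INR (n + n)) * / Gamma (1 + a - d - e) * F)).
      -- unfold Cdiv.
         transitivity (pochhammer (1 + a) (n + n) * / pochhammer (1 + a) (n + n) *
          (bailey_delta d e n *
           (/ Gamma (1 + a + INR (n + n)) * / Gamma (1 + a - d - e) * F))); [ring|].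
         rewrite Cinv_r by exact N1. ring.
      -- rewrite EF. unfold Cdiv.
         set (u := / Gamma (1 + a - d + INR n)). set (v := / Gamma (1 + a - e + INR n)).
         field. split; assumption.
Qed.

Lemma pochhammer_pos (x : R) (k : nat) :
  (0 < x)%R -> pochhammer x k = RtoC (Cmod (pochhammer x k)).
Proof.
intros h. induction k as [|k IH]; [simpl; now rewrite Cmod_1|].
rewrite pochhammer_S, Cmod_mult, RtoC_mult, <- IH. f_equal.
assert (T := pos_INR k). rewrite <- RtoC_plus, Cmod_R, Rabs_pos_eq by lra. reflexivity.
Qed.

Lemma sum_n_RtoC (v : nat -> R) n : sum_n (fun k => RtoC (v k)) n = RtoC (sum_n v n).
Proof.
induction n as [|n IH]; [now rewrite !sum_O|].
rewrite sum_n_C_S, sum_n_R_S, RtoC_plus, IH. reflexivity.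
Qed.

Lemma series_RtoC_pos_le (v : nat -> R) (g : C) n :
  (forall k, (0 <= v k)%R) -> is_series (fun k => RtoC (v k)) g ->
  (sum_n v n <= Cmod g)%R.
Proof.
intros H Hs.
assert (L : is_lim_seq (sum_n v) (Cmod g)).
{ apply is_lim_seq_ext with (fun n => Cmod (sum_n (fun k => RtoC (v k)) n)).
  - intros k. rewrite sum_n_RtoC, Cmod_R. apply Rabs_pos_eq, sum_n_R_nonneg, H.
  - apply Clim_Cmod, Hs. }
apply (is_lim_seq_incr_compare (sum_n v) _ L).
intros k. rewrite sum_n_R_S. specialize (H (S k)). lra.
Qed.

(* The Gauss sum with [d = e = 1] and excess [sigma] has positive terms, so
   its value bounds every partial sum. *)
Lemma bailey_row_bound_real (sigma : R) : (0 < sigma)%R ->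
  exists K, (0 < K)%R /\ forall n M,
   (sum_n (fun m => Cmod (bailey_kernel (1 + sigma)%R n m * bailey_delta 1 1 m)) M
     <= K * Rpower (INR (S n)) (- 2 * sigma))%R.
Proof.
intros hs.
assert (Hs : ~ nonpos_int sigma) by (apply Re_pos_not_nonpos_int; exact hs).
assert (Ha : ~ nonpos_int (1 + (1 + sigma)%R)) by (apply Re_pos_not_nonpos_int; simpl; lra).
assert (Ed : 1 + (1 + sigma)%R - 1 = 1 + sigma) by (rewrite RtoC_plus; ring).
assert (Es : 1 + (1 + sigma)%R - 1 - 1 = sigma) by (rewrite RtoC_plus; ring).
assert (Hd : ~ nonpos_int (1 + sigma)) by (apply Re_pos_not_nonpos_int; simpl; lra).
(* The closed form of the row is a constant times (n! / (1 + sigma)_n)^2, of order n^(-2 sigma). *)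
destruct (O_pow_scal (Gamma (1 + (1 + sigma)%R) * Gamma sigma * (/ Gamma (1 + sigma) * / Gamma (1 + sigma))) _ _
  (O_pow_mult _ _ _ _ (O_pow_inv_pochhammer _ Hd) (O_pow_inv_pochhammer _ Hd))) as [K [K0 HK]].
exists K. split; [exact K0|]. intros n M.
destruct (bailey_row_sum (1 + sigma)%R 1 1 n Ha) as [g [Hg Eg]];
  [rewrite Ed; exact Hd|rewrite Ed; exact Hd|right; right; simpl; lra|].
rewrite Es, Ed in Eg.
apply Rle_trans with (Cmod g).
- apply series_RtoC_pos_le with (v := fun m => Cmod (bailey_kernel (1 + sigma)%R n m * bailey_delta 1 1 m)).
  + intros; apply Cmod_ge_0.
  + apply is_series_ext with (2 := Hg). intros m.
    unfold bailey_delta. rewrite pochhammer_1. unfold bailey_kernel. destruct (n <=? m)%nat.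
    * rewrite <- RtoC_plus, pochhammer_pos by lra.
      assert (P := pochhammer_neq_0 _ (m + n) Ha).
      rewrite <- RtoC_plus in P. apply Cmod_gt_0 in P.
      assert (Q := INR_fact_lt_0 (m - n)). assert (Q' := INR_fact_lt_0 m).
      rewrite <- !RtoC_mult, <- RtoC_inv, <- RtoC_mult by (apply Rgt_not_eq, Rmult_lt_0_compat; lra).
      rewrite Cmod_R, Rabs_pos_eq; [reflexivity|].
      apply Rmult_le_pos; [left; apply Rinv_0_lt_compat, Rmult_lt_0_compat; lra|apply Rmult_le_pos; lra].
    * rewrite Cmult_0_l, Cmod_0. reflexivity.
- replace g with (Gamma (1 + (1 + sigma)%R) * Gamma sigma * (/ Gamma (1 + sigma) * / Gamma (1 + sigma)) *
    (INR (fact n) / pochhammer (1 + sigma) n * (INR (fact n) / pochhammer (1 + sigma) n))).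
  + eapply Rle_trans; [apply HK|]. right. f_equal. f_equal. simpl. ring.
  + assert (G1 := Gamma_neq_0 _ Ha). assert (G2 := Gamma_neq_0 _ Hs).
    assert (P := pochhammer_neq_0 _ n Hd).
    transitivity (Gamma (1 + (1 + sigma)%R) * Gamma sigma *
      (/ Gamma (1 + (1 + sigma)%R) * / Gamma sigma * g)).
    * rewrite Eg. unfold bailey_delta. rewrite pochhammer_1.
      set (u := / Gamma (1 + sigma)). field. exact P.
    * field. auto.
Qed.

(** The ratio x / y lies between 1/2 and 1, so its p-th power is at most 2^|p| whatever the sign of
    p. *)
Lemma Rpower_div_le_2 (x y p : R) : (0 < x <= y)%R -> (y <= 2 * x)%R ->
  (Rpower x p * Rpower y (- p) <= Rpower 2 (Rabs p))%R.
Proof.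
intros h h2. unfold Rpower. rewrite <- exp_plus.
assert (L1 : (ln x <= ln y)%R) by (destruct (Rle_lt_or_eq_dec x y) as [q| ->]; [lra|left; apply ln_increasing; lra|lra]).
assert (L2 : (ln y <= ln 2 + ln x)%R).
{ rewrite <- ln_mult by lra. destruct (Rle_lt_or_eq_dec _ _ h2) as [q| ->]; [left; apply ln_increasing; lra|lra]. }
assert (E : (p * ln x + - p * ln y <= Rabs p * ln 2)%R).
{ assert (T := Rle_abs (- p)). rewrite Rabs_Ropp in T. assert (T' := Rabs_pos p). nra. }
destruct (Rle_lt_or_eq_dec _ _ E) as [q| ->]; [left; now apply exp_increasing|lra].
Qed.

(** Termwise comparison with the positive row having d = e = 1 and a = 1 + sigma, which has excess
    sigma as well. The quotient of the terms is bounded by m^p (m + n)^(-p); since n <= m, the two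
    bases are comparable. *)
Lemma bailey_row_bound (a d e : C) : ~ nonpos_int (1 + a) ->
  (0 < Re (1 + a - d - e))%R ->
  exists K, (0 < K)%R /\ forall n M,
   (sum_n (fun m => Cmod (bailey_kernel a n m * bailey_delta d e m)) M
     <= K * Rpower (INR (S n)) (- 2 * Re (1 + a - d - e)))%R.
Proof.
intros Ha hs. set (sigma := Re (1 + a - d - e)) in *.
destruct (bailey_row_bound_real sigma hs) as [K [K0 HK]].
destruct (O_pow_mult _ _ _ _ (O_pow_pochhammer d) (O_pow_pochhammer e)) as [K1 [K10 HK1]].
destruct (O_pow_inv_pochhammer _ Ha) as [K2 [K20 HK2]].
destruct (O_pow_pochhammer (1 + (1 + sigma)%R)) as [K3 [K30 HK3]].
set (p := (Re d - 1 + (Re e - 1))%R) in *.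
set (L := (K1 * K2 * K3 * Rpower 2 (Rabs p))%R).
assert (L0 : (0 < L)%R).
{ unfold L. repeat apply Rmult_lt_0_compat; try assumption. apply Rpower_pos. }
assert (Hr : ~ nonpos_int (1 + (1 + sigma)%R)) by (apply Re_pos_not_nonpos_int; simpl; lra).
assert (term : forall n m, (Cmod (bailey_kernel a n m * bailey_delta d e m) <=
  L * Cmod (bailey_kernel (1 + sigma)%R n m * bailey_delta 1 1 m))%R).
{ intros n m. destruct (Nat.le_gt_cases n m) as [h|h].
  2:{ rewrite !bailey_kernel_lt by exact h. rewrite !Cmult_0_l, Cmod_0. lra. }
  unfold bailey_kernel. rewrite (proj2 (Nat.leb_le n m) h).
  set (f := RtoC (INR (fact m))). set (g := RtoC (INR (fact (m + n)))).
  assert (f0 : f <> 0) by apply RtoC_fact_neq_0. assert (g0 : g <> 0) by apply RtoC_fact_neq_0.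
  assert (h0 := RtoC_fact_neq_0 (m - n)).
  assert (F : bailey_delta 1 1 m = f * f).
  { unfold bailey_delta, f. now rewrite pochhammer_1. }
  assert (P := pochhammer_neq_0 _ (m + n) Ha). assert (P' := pochhammer_neq_0 _ (m + n) Hr).
  set (q := / INR (fact (m - n)) * / g * f * f).
  replace (/ (INR (fact (m - n)) * pochhammer (1 + a) (m + n)) * bailey_delta d e m) with
    (q * ((pochhammer d m / f * (pochhammer e m / f)) * (g / pochhammer (1 + a) (m + n))))
    by (unfold q, bailey_delta; field; auto).
  (* A lower bound for the reference term, obtained by inverting the upper growth bound of (2 +
     sigma)_(m + n). *)
  assert (B : (1 <= Cmod (/ (pochhammer (1 + (1 + sigma)%R) (m + n) / g)) *
     (K3 * Rpower (INR (S (m + n))) (Re (1 + (1 + sigma)%R) - 1)))%R).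
  { assert (Z : pochhammer (1 + (1 + sigma)%R) (m + n) / g <> 0).
    { intros E. apply P'.
      replace (pochhammer (1 + (1 + sigma)%R) (m + n)) with
        (pochhammer (1 + (1 + sigma)%R) (m + n) / g * g) by (field; exact g0).
      rewrite E. ring. }
    rewrite Cmod_inv by exact Z. apply Cmod_gt_0 in Z.
    apply Rmult_le_reg_l with (Cmod (pochhammer (1 + (1 + sigma)%R) (m + n) / g)); [exact Z|].
    rewrite <- Rmult_assoc, Rinv_r, Rmult_1_r, Rmult_1_l by lra. apply HK3. }
  replace (/ (INR (fact (m - n)) * pochhammer (1 + (1 + sigma)%R) (m + n)) * bailey_delta 1 1 m) with
    (q * / (pochhammer (1 + (1 + sigma)%R) (m + n) / g))
    by (rewrite F; unfold q; field; auto).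
  rewrite (Cmod_mult q (_ * _)), (Cmod_mult q (/ _)).
  rewrite (Rmult_comm L), Rmult_assoc. apply Rmult_le_compat_l; [apply Cmod_ge_0|].
  set (w := Cmod (/ (pochhammer (1 + (1 + sigma)%R) (m + n) / g))) in *.
  assert (w0 : (0 <= w)%R) by apply Cmod_ge_0.
  rewrite Cmod_mult.
  specialize (HK1 m). specialize (HK2 (m + n)%nat). fold f in HK1. fold g in HK2.
  set (x := INR (S m)) in *. set (y := INR (S (m + n))) in *.
  assert (x0 : (0 < x)%R) by apply INR_S_pos.
  assert (xy : (x <= y)%R) by (apply le_INR; lia).
  assert (yx : (y <= 2 * x)%R).
  { unfold x, y. replace 2%R with (INR 2) by reflexivity. rewrite <- mult_INR. apply le_INR. lia. }
  assert (D := Rpower_div_le_2 x y p (conj x0 xy) yx).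
  replace (Re (1 + (1 + sigma)%R) - 1)%R with (1 + sigma)%R in B by (simpl; ring).
  apply Rle_trans with ((K1 * Rpower x p) * (K2 * Rpower y (1 - Re (1 + a))))%R.
  { apply Rmult_le_compat; auto using Cmod_ge_0. }
  apply Rle_trans with ((K1 * Rpower x p) * (K2 * Rpower y (1 - Re (1 + a))) *
     (w * (K3 * Rpower y (1 + sigma))))%R.
  { rewrite <- (Rmult_1_r (K1 * Rpower x p * _)) at 1. apply Rmult_le_compat_l; [|exact B].
    left. repeat apply Rmult_lt_0_compat; try assumption; apply Rpower_pos. }
  replace (K1 * Rpower x p * (K2 * Rpower y (1 - Re (1 + a))) *
     (w * (K3 * Rpower y (1 + sigma))))%R with
   (w * (K1 * K2 * K3 * (Rpower x p * (Rpower y (1 - Re (1 + a)) * Rpower y (1 + sigma)))))%R by ring.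
  rewrite <- Rpower_plus.
  replace (1 - Re (1 + a) + (1 + sigma))%R with (- p)%R
    by (unfold p, sigma; destruct a, d, e; simpl; ring).
  apply Rmult_le_compat_l; [exact w0|]. unfold L. apply Rmult_le_compat_l; [|exact D].
  left. repeat apply Rmult_lt_0_compat; assumption. }
exists (L * K)%R. split; [now apply Rmult_lt_0_compat|].
intros n M.
apply Rle_trans with (L * sum_n (fun m => Cmod (bailey_kernel (1 + sigma)%R n m * bailey_delta 1 1 m)) M)%R.
- clear -term. induction M as [|M IH]; [rewrite !sum_O; apply term|].
  rewrite !sum_n_R_S. specialize (term n (S M)). lra.
- rewrite Rmult_assoc. apply Rmult_le_compat_l; [lra|apply HK].
Qed.

Lemma O_pow_sign : O_pow (fun n => (-1)^n) 0.
Proof.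
exists 1%R. split; [lra|]. intros n. rewrite Cmod_pow, Rpower_O by apply INR_S_pos.
replace (Cmod (-1)) with 1%R by (rewrite Cmod_R, Rabs_left; lra). rewrite pow1. lra.
Qed.

Lemma bailey_alpha_O_pow (a c : C) : ~ nonpos_int (1 + a - c) ->
  O_pow (bailey_alpha a c) (2 * Re c - 2).
Proof.
intros H.
apply O_pow_ext with (fun n => (-1)^n * (pochhammer a n / INR (fact n)) *
  (pochhammer c n / INR (fact n)) * (INR (fact n) / pochhammer (1 + a - c) n)).
- intros n. unfold bailey_alpha. field. split; [now apply pochhammer_neq_0|apply RtoC_fact_neq_0].
- replace (2 * Re c - 2)%R with (0 + (Re a - 1) + (Re c - 1) + (1 - Re (1 + a - c)))%R
    by (destruct a, c; simpl; ring).
  apply O_pow_mult; [apply O_pow_mult; [apply O_pow_mult|]|];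
    auto using O_pow_sign, O_pow_pochhammer, O_pow_inv_pochhammer.
Qed.

Lemma sum_n_Cmult_r (u : nat -> C) (k : C) n :
  sum_n (fun i => u i * k) n = sum_n u n * k.
Proof.
induction n as [|n IH]; [now rewrite !sum_O|].
rewrite !sum_n_C_S, IH.
C_eq. ring.
Qed.

Lemma Rsum_n_scal_l (v : nat -> R) (k : R) n :
  sum_n (fun i => (k * v i)%R) n = (k * sum_n v n)%R.
Proof.
induction n as [|n IH]; [now rewrite !sum_O|].
rewrite !sum_n_R_S, IH.
R_eq. ring.
Qed.

(** Either all rows are finite, or with sigma = Re (1 + a - d - e) the row bound n^(-2 sigma) times
    n^(2 Re c - 2), the size of [bailey_alpha], is summable: 2 Re c - 2 - 2 sigma < -1. *)
Definition bailey_cvg (a c d e : C) : Prop :=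
  (nonpos_int d \/ nonpos_int e) \/
  (0 < Re (1 + a - d - e) /\ Re c - Re (1 + a - d - e) < 1 / 2)%R.

Lemma bailey_dominated (a c d e : C) :
  ~ nonpos_int (1 + a) -> ~ nonpos_int (1 + a - c) -> bailey_cvg a c d e ->
  exists G, ex_series G /\ forall n M, (sum_n (fun m =>
    Cmod (bailey_alpha a c n * (bailey_kernel a n m * bailey_delta d e m))) M <= G n)%R.
Proof.
intros Ha Hac [h|[h1 h2]].
- destruct (bailey_delta_eq_0 d e h) as [N HN].
  set (x := fun n m => Cmod (bailey_alpha a c n * (bailey_kernel a n m * bailey_delta d e m))).
  assert (x0 : forall n m, (N <= m)%nat -> x n m = 0%R).
  { intros n m hm. unfold x. rewrite HN, !Cmult_0_r by exact hm. apply Cmod_0. }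
  assert (p : forall n m, (0 <= x n m)%R) by (intros; apply Cmod_ge_0).
  assert (S : forall n k, (sum_n (x n) (N + k) <= sum_n (x n) N)%R).
  { intros n k. induction k as [|k IH]; [rewrite Nat.add_0_r; lra|].
    rewrite Nat.add_succ_r, sum_n_R_S, x0 by lia. lra. }
  (* The modulus only serves to apply the [O_pow] criterion, which concerns complex sequences. The
     sum is 0 for n > N because the kernel vanishes there. *)
  exists (fun n => Cmod (RtoC (sum_n (x n) N))). split.
  + apply O_pow_ex_series_Cmod with (-2)%R; [lra|]. apply O_pow_finite with (Datatypes.S N).
    intros n hn. f_equal.
    assert (Z : forall k, (k <= N)%nat -> sum_n (x n) k = 0%R).
    { assert (Z' : forall m, (m <= N)%nat -> x n m = 0%R).
      { intros m hm. unfold x. rewrite bailey_kernel_lt by lia.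
        rewrite Cmult_0_l, Cmult_0_r. apply Cmod_0. }
      induction k as [|k IH]; intros hk; [rewrite sum_O; now apply Z'|].
      rewrite sum_n_R_S, IH, Z' by lia. apply Rplus_0_r. }
    now apply Z.
  + intros n M. rewrite Cmod_R, Rabs_pos_eq by (apply sum_n_R_nonneg, p).
    destruct (Nat.le_gt_cases N M) as [hM|hM].
    * replace M with (N + (M - N))%nat by lia. apply S.
    * replace N with (M + (N - M))%nat by lia. generalize (N - M)%nat as k.
      change (forall k, (sum_n (x n) M <= sum_n (x n) (M + k))%R).
      induction k as [|k IH]; [rewrite Nat.add_0_r; lra|].
      rewrite Nat.add_succ_r, sum_n_R_S. specialize (p n (Datatypes.S (M + k))). lra.
- destruct (bailey_row_bound a d e Ha h1) as [K [K0 HK]].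
  set (sigma := Re (1 + a - d - e)) in *.
  exists (fun n => Cmod (bailey_alpha a c n * RtoC (K * Rpower (INR (S n)) (- 2 * sigma)))).
  split.
  + apply O_pow_ex_series_Cmod with (2 * Re c - 2 + - 2 * sigma)%R; [lra|].
    apply O_pow_mult; [now apply bailey_alpha_O_pow|].
    exists K. split; [exact K0|]. intros n. rewrite Cmod_R, Rabs_pos_eq; [lra|].
    apply Rmult_le_pos; [lra|left; apply Rpower_pos].
  + intros n M. rewrite (sum_n_ext _ (fun m => Cmod (bailey_alpha a c n) *
      Cmod (bailey_kernel a n m * bailey_delta d e m))%R) by (intros; apply Cmod_mult).
    rewrite Rsum_n_scal_l, Cmod_mult.
    apply Rmult_le_compat_l; [apply Cmod_ge_0|].
    rewrite Cmod_R, Rabs_pos_eq; [apply HK|].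
    apply Rmult_le_pos; [lra|left; apply Rpower_pos].
Qed.

(** Bailey's lemma: the sum of alpha_n gamma_n equals the sum of beta_m delta_m. A pole of Gamma at
    1 + a - d - e is allowed and makes the well-poised sum 0. *)
Lemma well_poised_transformation (a c d e : C) :
  ~ nonpos_int (1 + a) -> ~ nonpos_int (1 + a - c) ->
  ~ nonpos_int (1 + a - d) -> ~ nonpos_int (1 + a - e) -> bailey_cvg a c d e ->
  exists l,
    is_series (fun m => pochhammer (1 + a / 2 - c) m
      / (INR (fact m) * pochhammer (1 + a / 2) m * pochhammer (1 + a - c) m)
      * bailey_delta d e m) l /\
    is_series (fun n => bailey_alpha a c n *
      (bailey_delta d e n / (pochhammer (1 + a - d) n * pochhammer (1 + a - e) n)))
      (Gamma (1 + a - d) * Gamma (1 + a - e) * / Gamma (1 + a) * / Gamma (1 + a - d - e) * l).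
Proof.
intros Ha Hc Hd He Hcv.
assert (Hg : gauss_cvg d e (1 + a)).
{ destruct Hcv as [[h|h]|[h _]]; [now left|right; now left|right; now right]. }
assert (row := fun n => bailey_row_sum a d e n Ha Hd He Hg).
(* [CSeries] turns the existence of each row sum into a function of n without a choice principle. *)
set (g := fun n => CSeries (fun m => bailey_kernel a n m * bailey_delta d e m)).
assert (Hrow : forall n, is_series (fun m => bailey_kernel a n m * bailey_delta d e m) (g n) /\
    / Gamma (1 + a) * / Gamma (1 + a - d - e) * g n =
    / Gamma (1 + a - d) * / Gamma (1 + a - e) *
      (bailey_delta d e n / (pochhammer (1 + a - d) n * pochhammer (1 + a - e) n))).
{ intros n. destruct (row n) as [x [Hx Ex]]. unfold g. rewrite (CSeries_unique _ _ Hx). now split. }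
destruct (bailey_dominated a c d e Ha Hc Hcv) as [G [exG HG]].
destruct (triangular_fubini
  (fun n m => bailey_alpha a c n * (bailey_kernel a n m * bailey_delta d e m)) G
  (fun n => bailey_alpha a c n * g n)) as [l [Hl1 Hl2]].
- intros n m h. rewrite bailey_kernel_lt by exact h. ring.
- exact HG.
- exact exG.
- intros n. apply is_series_Cmult_l, Hrow.
- exists l. split.
  + apply is_series_ext with (2 := Hl2). intros m.
    rewrite <- dixon_sum by assumption.
    rewrite <- (sum_n_Cmult_r (fun n => bailey_alpha a c n * bailey_kernel a n m)).
    apply sum_n_ext. intros n. C_eq. ring.
  + apply is_series_ext with (fun n => Gamma (1 + a - d) * Gamma (1 + a - e) * / Gamma (1 + a)
      * / Gamma (1 + a - d - e) * (bailey_alpha a c n * g n)).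
    * intros n. destruct (Hrow n) as [_ E].
      C_eq.
      transitivity (bailey_alpha a c n * (Gamma (1 + a - d) * Gamma (1 + a - e) *
        (/ Gamma (1 + a) * / Gamma (1 + a - d - e) * g n))); [ring|].
      rewrite E. assert (G1 := Gamma_neq_0 _ Hd). assert (G2 := Gamma_neq_0 _ He).
      field. repeat split; auto using pochhammer_neq_0.
    * apply is_series_Cmult_l, Hl1.
Qed.

(* On a block of length proportional to [M] starting at [M], [t] stays within
   [|t M| / 2] of [t M], so the block sum is bounded away from 0. *)
Lemma slowly_varying_not_ex_series (t : nat -> C) (K c : R) :
  (0 < c)%R -> (forall n, (c / INR (S n) <= Cmod (t n))%R) ->
  (forall n, (Cmod (t (S n) - t n) <= K / INR (S n) * Cmod (t n))%R) ->
  ~ ex_series t.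
Proof.
intros c0 Hc HK [l Hl].
destruct (INR_unbounded K) as [k0 Hk0].
set (k := INR (S k0)). assert (k1 : (1 <= k)%R) by (apply (le_INR 1); lia).
assert (Kk : (K <= k)%R) by (unfold k; rewrite S_INR; lra).
(* A block of length J has a sum of modulus at least J |t M| / 2, and J |t M| >= J c / (M + 1) >= c
   / (4 k + 1) = 2 eta. The Cauchy criterion with eta is then violated. *)
set (eta := (c / (2 * (4 * k + 1)))%R).
assert (eta0 : (0 < eta)%R) by (apply Rdiv_lt_0_compat; lra).
apply is_series_sum_n in Hl. apply Clim_Cmod_iff in Hl.
assert (eta2 : (0 < eta / 2)%R) by lra.
destruct (proj2 (is_lim_seq_spec _ _) Hl (mkposreal _ eta2)) as [N HN]. simpl in HN.
(* With M = 4 k J, up to J steps of relative size 2 k / M each change t by at most half of |t M|. *)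
set (J := S N). set (M := (4 * S k0 * J)%nat).
assert (J0 : (1 <= INR J)%R) by (apply (le_INR 1); unfold J; lia).
assert (EM : INR M = (4 * k * INR J)%R) by (unfold M, k; rewrite !mult_INR; simpl (INR 4); ring).
assert (HM : (N <= M)%nat) by (unfold M, J; nia).
assert (tM := Cmod_ge_0 (t M)).
assert (near : forall j, (j <= J)%nat ->
  (Cmod (t (M + j)%nat - t M) <= INR j * (2 * k / INR M) * Cmod (t M))%R).
{ assert (M0 : (0 < INR M)%R) by nra.
  assert (iM : (0 < / INR M)%R) by now apply Rinv_0_lt_compat.
  induction j as [|j IH]; intros hj.
  - rewrite Nat.add_0_r. replace (t M - t M) with (RtoC 0) by ring. rewrite Cmod_0. simpl. lra.
  - specialize (IH ltac:(lia)).
    assert (Jj : (INR j <= INR J)%R) by (apply le_INR; lia).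
    assert (half : (INR j * (2 * k / INR M) <= 1 / 2)%R).
    { rewrite EM. apply Rle_trans with (INR J * (2 * k / (4 * k * INR J)))%R.
      - apply Rmult_le_compat_r; [|lra]. left. apply Rdiv_lt_0_compat; nra.
      - right. field. lra. }
    assert (b : (Cmod (t (M + j)%nat) <= 2 * Cmod (t M))%R).
    { assert (T := Cmod_triangle (t (M + j)%nat - t M) (t M)).
      replace (t (M + j)%nat - t M + t M) with (t (M + j)%nat) in T by ring. nra. }
    rewrite Nat.add_succ_r.
    replace (t (S (M + j)) - t M) with ((t (S (M + j)) - t (M + j)%nat) + (t (M + j)%nat - t M)) by ring.
    eapply Rle_trans; [apply Cmod_triangle|].
    assert (s : (Cmod (t (S (M + j)) - t (M + j)%nat) <= 2 * k / INR M * Cmod (t M))%R).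
    { eapply Rle_trans; [apply HK|].
      assert (i1 : (0 < / INR (S (M + j)))%R) by apply Rinv_0_lt_compat, INR_S_pos.
      assert (i2 : (/ INR (S (M + j)) <= / INR M)%R).
      { apply Rinv_le_contravar; [exact M0|]. apply le_INR. lia. }
      assert (Q : (0 <= Cmod (t (M + j)%nat))%R) by apply Cmod_ge_0.
      apply Rle_trans with (k / INR M * (2 * Cmod (t M)))%R; [|right; field; lra].
      apply Rle_trans with (k / INR M * Cmod (t (M + j)%nat))%R.
      - apply Rmult_le_compat_r; [exact Q|]. unfold Rdiv. nra.
      - apply Rmult_le_compat_l; [|exact b]. unfold Rdiv. nra. }
    rewrite (S_INR j). nra. }
assert (block : forall j, (j <= J)%nat ->
  (Cmod (sum_n t (M + j) - sum_n t M - INR j * t M) <= INR j * (1 / 2 * Cmod (t M)))%R).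
{ induction j as [|j IH]; intros hj.
  - rewrite Nat.add_0_r. replace (sum_n t M - sum_n t M - INR 0 * t M) with (RtoC 0) by (simpl; ring).
    rewrite Cmod_0. simpl. lra.
  - specialize (IH ltac:(lia)). rewrite Nat.add_succ_r, sum_n_C_S.
    replace (sum_n t (M + j) + t (S (M + j)) - sum_n t M - INR (S j) * t M) with
      ((sum_n t (M + j) - sum_n t M - INR j * t M) + (t (M + S j)%nat - t M))
      by (rewrite RtoC_INR_S, Nat.add_succ_r; ring).
    eapply Rle_trans; [apply Cmod_triangle|].
    assert (half : (INR (S j) * (2 * k / INR M) <= 1 / 2)%R).
    { rewrite EM. apply Rle_trans with (INR J * (2 * k / (4 * k * INR J)))%R.
      - apply Rmult_le_compat_r; [|now apply le_INR]. left. apply Rdiv_lt_0_compat; nra.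
      - right. field. lra. }
    specialize (near (S j) hj). rewrite (S_INR j) in *. nra. }
specialize (block J (le_n _)).
assert (d1 := HN M HM). assert (d2 := HN (M + J)%nat ltac:(lia)).
rewrite Rminus_0_r, Rabs_pos_eq in d1 by apply Cmod_ge_0.
rewrite Rminus_0_r, Rabs_pos_eq in d2 by apply Cmod_ge_0.
assert (T1 := Cmod_triangle (sum_n t (M + J) - l) (- (sum_n t M - l))).
rewrite Cmod_opp in T1.
assert (T2 := Cmod_triangle (- (sum_n t (M + J) - sum_n t M - INR J * t M))
   ((sum_n t (M + J) - l) + - (sum_n t M - l))).
rewrite Cmod_opp in T2.
replace (- (sum_n t (M + J) - sum_n t M - INR J * t M) + (sum_n t (M + J) - l + - (sum_n t M - l)))
  with (INR J * t M) in T2 by ring.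
rewrite Cmod_mult, Cmod_R, Rabs_pos_eq in T2 by lra.
assert (L : (2 * eta <= INR J * Cmod (t M))%R).
{ apply Rle_trans with (INR J * (c / INR (S M)))%R; [|apply Rmult_le_compat_l; [lra|apply Hc]].
  rewrite S_INR, EM. unfold eta.
  replace (2 * (c / (2 * (4 * k + 1))))%R with (c * / (4 * k + 1))%R by (field; lra).
  replace (INR J * (c / (4 * k * INR J + 1)))%R with (c * / (4 * k + / INR J))%R
    by (field; split; nra).
  apply Rmult_le_compat_l; [lra|].
  assert (i : (0 < / INR J <= 1)%R).
  { split; [apply Rinv_0_lt_compat; lra|]. rewrite <- Rinv_1. apply Rinv_le_contravar; lra. }
  apply Rinv_le_contravar; lra. }
assert (T := Rle_lt_trans _ _ _ (Rle_trans _ _ _ T2 (Rplus_le_compat _ _ _ _ block T1))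
  (Rplus_lt_compat_l _ _ _ (Rplus_lt_compat _ _ _ _ d2 d1))).
lra.
Qed.

(** * Divergence of the 3F2 *)

Lemma O_pow_plus (u v : nat -> C) (p : R) :
  O_pow u p -> O_pow v p -> O_pow (fun n => u n + v n) p.
Proof.
intros [K [K0 H]] [L [L0 G]]. exists (K + L)%R. split; [lra|].
intros n. eapply Rle_trans; [apply Cmod_triangle|].
specialize (H n). specialize (G n). lra.
Qed.

Definition ratio_near_1 (r : nat -> C) : Prop := O_pow (fun n => r n - 1) (-1).

Lemma ratio_near_1_mult (r s : nat -> C) :
  ratio_near_1 r -> ratio_near_1 s -> ratio_near_1 (fun n => r n * s n).
Proof.
intros Hr Hs. unfold ratio_near_1 in *.
apply O_pow_ext with (fun n => (r n - 1) * (s n - 1) + ((r n - 1) + (s n - 1)));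
  [intros; ring|].
apply O_pow_plus; [|now apply O_pow_plus].
apply O_pow_weaken with (-1 + -1)%R; [lra|now apply O_pow_mult].
Qed.

Lemma ratio_near_1_shift (x y : C) : ~ nonpos_int y ->
  ratio_near_1 (fun n => (x + INR n) / (y + INR n)).
Proof.
intros H.
assert (L := Clim_inv _ _ C1_nz (Clim_plus_INR_div_S y)).
destruct (Clim_bounded _ _ L) as [M [M0 HM]].
unfold ratio_near_1.
apply O_pow_ext with (fun n => (x - y) * (/ ((y + INR n) / INR (S n)) * / INR (S n))).
- intros n. assert (Q := nonpos_int_factor y n H). field. split; [exact Q|apply RtoC_INR_S_neq_0].
- apply O_pow_scal. exists M. split; [exact M0|]. intros n.
  assert (P := INR_S_pos n).
  rewrite Cmod_mult, (Cmod_inv (INR (S n))), Cmod_R, Rabs_pos_eq by (lra || apply RtoC_INR_S_neq_0).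
  replace (-1)%R with (- (1))%R by ring. rewrite Rpower_Ropp, Rpower_1 by exact P.
  apply Rmult_le_compat_r; [left; now apply Rinv_0_lt_compat|apply HM].
Qed.

(** The terms are at least a constant over n in modulus, but with complex parameters their arguments
    may rotate. Consecutive ratios are 1 + O(1/n), so the rotation is too slow for cancellation
    within a block of length proportional to its starting index. *)
Lemma hyp3F2_not_ex_series (p d e q r : C) :
  ~ nonpos_int p -> ~ nonpos_int d -> ~ nonpos_int e -> ~ nonpos_int q -> ~ nonpos_int r ->
  (Re (q + r - p - d - e) <= 0)%R ->
  ~ ex_series (fun m => pochhammer p m / (INR (fact m) * pochhammer q m * pochhammer r m)
      * (pochhammer d m * pochhammer e m)).
Proof.
intros Hp Hd He Hq Hr Hs.
set (t := fun m => pochhammer p m / (INR (fact m) * pochhammer q m * pochhammer r m)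
      * (pochhammer d m * pochhammer e m)).
assert (nz : forall x m, ~ nonpos_int x -> pochhammer x m <> 0) by (intros; now apply pochhammer_neq_0).
assert (t0 : forall n, t n <> 0).
{ intros n E.
  assert (Z : t n * (INR (fact n) * pochhammer q n * pochhammer r n) =
    pochhammer p n * (pochhammer d n * pochhammer e n)).
  { unfold t. field. repeat split; auto using RtoC_fact_neq_0. }
  rewrite E, Cmult_0_l in Z. symmetry in Z. revert Z.
  repeat apply Cmult_neq_0; auto. }
(* The lower bound on the terms is expressed as an upper bound on their inverses. *)
assert (inv : O_pow (fun n => / t n) 1).
{ apply O_pow_weaken with (1 - Re p + (1 - Re d) + (1 - Re e) + (Re q - 1) + (Re r - 1))%R.
  - destruct p, d, e, q, r; simpl in *. lra.
  - apply O_pow_ext with (fun n => INR (fact n) / pochhammer p n * (INR (fact n) / pochhammer d n)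
      * (INR (fact n) / pochhammer e n) * (pochhammer q n / INR (fact n)) * (pochhammer r n / INR (fact n))).
    + intros n. unfold t. field. repeat split; auto using RtoC_fact_neq_0.
    + repeat (apply O_pow_mult; [|apply O_pow_pochhammer]).
      apply O_pow_mult; [apply O_pow_mult|]; now apply O_pow_inv_pochhammer. }
destruct inv as [K [K0 HK]].
assert (rat : ratio_near_1 (fun n => (p + INR n) / (1 + INR n) *
   ((d + INR n) / (q + INR n)) * ((e + INR n) / (r + INR n)))).
{ assert (~ nonpos_int 1) by (apply Re_pos_not_nonpos_int; simpl; lra).
  apply ratio_near_1_mult; [apply ratio_near_1_mult|]; now apply ratio_near_1_shift. }
destruct rat as [L [L0 HL]].
apply slowly_varying_not_ex_series with L (/ K)%R.
- now apply Rinv_0_lt_compat.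
- intros n. specialize (HK n). rewrite Rpower_1 in HK by apply INR_S_pos.
  rewrite Cmod_inv in HK by apply t0.
  assert (P := proj1 (Cmod_gt_0 _) (t0 n)). assert (Q := INR_S_pos n).
  replace (/ K / INR (S n))%R with (/ (K * INR (S n)))%R by (field; lra).
  rewrite <- (Rinv_inv (Cmod (t n))). apply Rinv_le_contravar; [|exact HK].
  now apply Rinv_0_lt_compat.
- intros n. specialize (HL n).
  replace (-1)%R with (- (1))%R in HL by ring. rewrite Rpower_Ropp, Rpower_1 in HL by apply INR_S_pos.
  replace (t (S n) - t n) with (((p + INR n) / (1 + INR n) *
   ((d + INR n) / (q + INR n)) * ((e + INR n) / (r + INR n)) - 1) * t n).
  + rewrite Cmod_mult. apply Rmult_le_compat_r; [apply Cmod_ge_0|exact HL].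
  + unfold t. rewrite RtoC_fact_S, !pochhammer_S, RtoC_INR_S. field.
    assert (N := RtoC_INR_S_neq_0 n). rewrite RtoC_INR_S in N.
    repeat split; auto using RtoC_fact_neq_0, nonpos_int_factor.
Qed.

(** * Kummer's theorem *)

Definition kummer_term (A B : C) (k : nat) : C :=
  (-1)^k * gauss_term A B (1 + A - B) k.

Lemma kummer_term_O_pow (A B : C) : ~ nonpos_int (1 + A - B) ->
  O_pow (kummer_term A B) (2 * Re B - 2).
Proof.
intros H.
replace (2 * Re B - 2)%R with (0 + (- Re (1 + A - B - A - B) - 1))%R
  by (destruct A, B; simpl; ring).
apply O_pow_mult; [apply O_pow_sign|now apply gauss_term_O_pow].
Qed.

(** A telescoping identity. The step in A is 2 because Kummer's value involves Gamma at A / 2, so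
    that this step shifts every Gamma argument by an integer. *)
Lemma kummer_contiguous_sum (A B : C) (n : nat) : ~ nonpos_int (1 + A - B) ->
  (1 + A - B) * (2 + A - B) * sum_n (kummer_term A B) n
  - (1 + A) * (2 + A - 2 * B) * sum_n (kummer_term (A + 2) B) n =
  (B - 1) * B * ((-1)^n * (pochhammer (A + 1) n * pochhammer (B + 1) n
    / (INR (fact n) * pochhammer (3 + A - B) n))).
Proof.
intros H.
assert (H1 := nonpos_int_plus_INR _ 1 H). assert (H2 := nonpos_int_plus_INR _ 2 H).
replace (1 + A - B + INR 1) with (2 + A - B) in H1 by (simpl; ring).
replace (1 + A - B + INR 2) with (3 + A - B) in H2 by (simpl; rewrite RtoC_plus; ring).
induction n as [|n IH].
- rewrite !sum_O. unfold kummer_term, gauss_term. simpl. field.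
- rewrite !sum_n_C_S.
  transitivity (((1 + A - B) * (2 + A - B) * sum_n (kummer_term A B) n
    - (1 + A) * (2 + A - 2 * B) * sum_n (kummer_term (A + 2) B) n)
    + ((1 + A - B) * (2 + A - B) * kummer_term A B (S n)
    - (1 + A) * (2 + A - 2 * B) * kummer_term (A + 2) B (S n))); [ring|].
  rewrite IH. clear IH. unfold kummer_term, gauss_term.
  replace (1 + (A + 2) - B) with (3 + A - B) by ring.
  assert (p1 : pochhammer A (S n) = A * pochhammer (A + 1) n) by apply pochhammer_S_l.
  assert (p2 : (1 + A) * pochhammer (A + 2) (S n) =
     pochhammer (A + 1) n * ((A + 1 + INR n) * (A + 1 + INR (S n)))).
  { replace (A + 2) with (A + 1 + 1) by ring.
    replace (1 + A) with (A + 1) by ring.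
    rewrite <- pochhammer_S_l, !pochhammer_S. ring. }
  assert (p3 : pochhammer B (S n) = B * pochhammer (B + 1) n) by apply pochhammer_S_l.
  assert (E : (1 + A - B + INR n) * (1 + A - B + INR (S n)) * pochhammer (1 + A - B) n
     = (1 + A - B) * (2 + A - B) * pochhammer (3 + A - B) n).
  { transitivity (pochhammer (1 + A - B) (S (S n))); [rewrite !pochhammer_S; ring|].
    rewrite !pochhammer_S_l.
    replace (1 + A - B + 1) with (2 + A - B) by ring.
    replace (2 + A - B + 1) with (3 + A - B) by ring. ring. }
  assert (N0 := nonpos_int_factor _ n H). assert (N1 := nonpos_int_factor _ (S n) H).
  assert (N2 := pochhammer_neq_0 _ n H). assert (N3 := pochhammer_neq_0 _ n H2).
  assert (N4 := nonpos_int_factor _ n H2).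
  assert (E' : pochhammer (3 + A - B) n =
    (1 + A - B + INR n) * (1 + A - B + INR (S n)) * pochhammer (1 + A - B) n /
      ((1 + A - B) * (2 + A - B))).
  { rewrite E. assert (Q := nonpos_int_factor _ 0 H). assert (Q1 := nonpos_int_factor _ 0 H1).
    simpl in Q, Q1. rewrite Cplus_0_r in Q, Q1. field. split; assumption. }
  assert (Q := nonpos_int_factor _ 0 H). assert (Q1 := nonpos_int_factor _ 0 H1).
  simpl in Q, Q1. rewrite Cplus_0_r in Q, Q1.
  (* The factor 1 + A is grouped with (A + 2)_(n + 1) so that [p2] applies without dividing by 1 +
     A, which may vanish. *)
  transitivity ((B - 1) * B * ((-1) ^ n * (pochhammer (A + 1) n * pochhammer (B + 1) n /
    (INR (fact n) * pochhammer (3 + A - B) n)))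
    + (-1)^(S n) * ((1 + A - B) * (2 + A - B) * (pochhammer A (S n) * pochhammer B (S n) /
        (INR (fact (S n)) * pochhammer (1 + A - B) (S n)))
      - (2 + A - 2 * B) * (((1 + A) * pochhammer (A + 2) (S n)) * pochhammer B (S n) /
        (INR (fact (S n)) * pochhammer (3 + A - B) (S n))))).
  { unfold Cdiv. ring. }
  rewrite p1, p2, p3, RtoC_fact_S, !pochhammer_S, E', !RtoC_INR_S in *.
  change ((-1)^(S n)) with (-1 * (-1)^n).
  assert (F := RtoC_fact_neq_0 n). assert (F' := RtoC_INR_S_neq_0 n). rewrite RtoC_INR_S in F'.
  field. repeat split; assumption.
Qed.

Lemma Re_minus (z w : C) : Re (z - w) = (Re z - Re w)%R.
Proof. reflexivity. Qed.

(** The boundary term is O(n^(2 Re B - 2)), hence the condition on B. *)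
Lemma kummer_contiguous (A B K0 K1 : C) :
  ~ nonpos_int (1 + A - B) -> (Re B < 1)%R ->
  is_series (kummer_term A B) K0 -> is_series (kummer_term (A + 2) B) K1 ->
  (1 + A - B) * (2 + A - B) * K0 = (1 + A) * (2 + A - 2 * B) * K1.
Proof.
intros H HB H0 H1.
assert (H2 := nonpos_int_plus_INR _ 2 H).
replace (1 + A - B + INR 2) with (3 + A - B) in H2 by (simpl; rewrite RtoC_plus; ring).
apply Ceq_minus.
apply (Clim_unique (fun n => (1 + A - B) * (2 + A - B) * sum_n (kummer_term A B) n
  + - ((1 + A) * (2 + A - 2 * B)) * sum_n (kummer_term (A + 2) B) n)).
- replace ((1 + A - B) * (2 + A - B) * K0 - (1 + A) * (2 + A - 2 * B) * K1) with
   ((1 + A - B) * (2 + A - B) * K0 + - ((1 + A) * (2 + A - 2 * B)) * K1) by ring.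
  apply Clim_plus; apply Clim_mult; try apply Clim_const; assumption.
- apply Clim_ext with (fun n => (B - 1) * B * ((-1)^n * gauss_term (A + 1) (B + 1) (3 + A - B) n)).
  + intros n. unfold gauss_term. rewrite <- kummer_contiguous_sum by exact H. ring.
  + replace (RtoC 0) with ((B - 1) * B * 0) by ring.
    apply Clim_mult; [apply Clim_const|].
    apply O_pow_Clim_0 with (0 + (- Re (3 + A - B - (A + 1) - (B + 1)) - 1))%R.
    * destruct A, B; simpl in *. lra.
    * apply O_pow_mult; [apply O_pow_sign|now apply gauss_term_O_pow].
Qed.

(* With [c = e = (1 + A) / 2] the well-poised transformation leads to a 2F1 at
   unit argument, which Gauss' theorem evaluates; the excess is
   [(1 + A) / 2 - B], whence the restriction on [A]. *)
Lemma kummer_summation_pos (A B : C) :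
  ~ nonpos_int (1 + A - B) -> (Re B < 1 / 2)%R -> (0 < Re A)%R ->
  exists K, is_series (kummer_term A B) K /\
    / Gamma (1 + A - B) * / Gamma (1 + A / 2) * K = / Gamma (1 + A) * / Gamma (1 + A / 2 - B).
Proof.
intros H HB HA. set (c := (1 + A) / 2).
assert (Rc : Re c = ((1 + Re A) / 2)%R).
{ unfold c. destruct A as [x y]. unfold Cdiv, Cmult, Cinv, Cplus, RtoC, Re. simpl. field. }
assert (Ha : ~ nonpos_int (1 + A)) by (apply Re_pos_not_nonpos_int; destruct A; simpl in *; lra).
assert (Hh := half_not_nonpos_int A Ha).
assert (Hc : ~ nonpos_int c) by (apply Re_pos_not_nonpos_int; rewrite Rc; lra).
(* Since c is its own well-poised partner, the parameters c and e = c cancel against their partners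
   and a 2F1(-1) remains. On the other side 1 + A / 2 - c = 1/2, and (c)_m cancels once. *)
assert (Ec : 1 + A - c = c) by (unfold c; field).
assert (Es : 1 + A - B - c = c - B) by (rewrite <- Ec at 2; ring).
destruct (well_poised_transformation A c B c) as [l [L1 L2]]; try (rewrite ?Ec; assumption).
{ right. rewrite Es, Re_minus, Rc. lra. }
rewrite Ec, Es in L2.
destruct (gauss_summation (1/2) B (1 + A / 2) Hh) as [l' [L1' G]].
{ right; right. replace (1 + A / 2 - 1 / 2 - B) with (c - B) by (unfold c; field).
  rewrite Re_minus, Rc. lra. }
assert (l = l').
{ apply (Clim_unique (sum_n (gauss_term (1/2) B (1 + A / 2)))); [|exact L1'].
  apply is_series_sum_n. apply is_series_ext with (2 := L1). intros n.
  C_eq.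
  rewrite Ec. replace (1 + A / 2 - c) with (1/2 : C) by (unfold c; field).
  unfold gauss_term, bailey_delta. field.
  repeat split; auto using RtoC_fact_neq_0, pochhammer_neq_0. }
subst l'. eexists. split.
- apply is_series_ext with (2 := L2). intros n.
  C_eq.
  unfold kummer_term, gauss_term, bailey_alpha, bailey_delta. rewrite Ec. field.
  repeat split; auto using RtoC_fact_neq_0, pochhammer_neq_0.
- replace (1 + A / 2 - 1 / 2 - B) with (c - B) in G by (unfold c; field).
  replace (1 + A / 2 - 1 / 2) with c in G by (unfold c; field).
  assert (G1 := Gamma_neq_0 _ H). assert (G2 := Gamma_neq_0 _ Hc).
  transitivity (/ Gamma (1 + A - B) * Gamma (1 + A - B) * Gamma c * / Gamma (1 + A) *
    (/ Gamma (1 + A / 2) * / Gamma (c - B) * l)); [ring|].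
  rewrite G, Cinv_l by exact G1.
  transitivity (Gamma c * / Gamma c * (/ Gamma (1 + A) * / Gamma (1 + A / 2 - B))); [ring|].
  rewrite Cinv_r by exact G2. ring.
Qed.

(** The growth exponent 2 Re B - 2 of the terms does not involve A, so the series converges all
    along the descent from A + 2 to A. *)
Lemma kummer_summation (A B : C) :
  ~ nonpos_int (1 + A - B) -> (Re B < 1 / 2)%R ->
  exists K, is_series (kummer_term A B) K /\
    / Gamma (1 + A - B) * / Gamma (1 + A / 2) * K = / Gamma (1 + A) * / Gamma (1 + A / 2 - B).
Proof.
intros H HB.
destruct (INR_unbounded (- Re A)) as [N HN].
assert (HN' : (0 < Re A + 2 * INR N)%R) by (assert (T := pos_INR N); lra).
clear HN. revert A H HN'.
induction N as [|N IH]; intros A H HN.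
- apply kummer_summation_pos; auto. simpl in HN. lra.
- assert (H2 := nonpos_int_plus_INR _ 2 H).
  replace (1 + A - B + INR 2) with (1 + (A + 2) - B) in H2 by (simpl; rewrite RtoC_plus; ring).
  destruct (IH (A + 2) H2) as [K1 [HK1 E1]].
  { rewrite S_INR in HN. destruct A; simpl in *. lra. }
  assert (ex : ex_series (kummer_term A B)).
  { apply O_pow_ex_series with (2 * Re B - 2)%R; [lra|now apply kummer_term_O_pow]. }
  destruct ex as [K0 HK0]. exists K0. split; [exact HK0|].
  assert (R := kummer_contiguous A B K0 K1 H ltac:(lra) HK0 HK1).
  (* Everything is moved to the arguments belonging to A + 2: two steps for 1 + A - B and 1 + A, one
     for the arguments containing A / 2. *)
  rewrite (inv_Gamma_S (1 + A - B)), (inv_Gamma_S (1 + A - B + 1)), (inv_Gamma_S (1 + A / 2)),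
    (inv_Gamma_S (1 + A)), (inv_Gamma_S (1 + A + 1)), (inv_Gamma_S (1 + A / 2 - B)).
  replace (1 + A - B + 1 + 1) with (1 + (A + 2) - B) by ring.
  replace (1 + A + 1 + 1) with (1 + (A + 2)) by ring.
  replace (1 + A / 2 + 1) with (1 + (A + 2) / 2) by field.
  replace (1 + A / 2 - B + 1) with (1 + (A + 2) / 2 - B) by field.
  set (g1 := / Gamma (1 + (A + 2) - B)) in *. set (g2 := / Gamma (1 + (A + 2) / 2)) in *.
  set (g3 := / Gamma (1 + (A + 2))) in *. set (g4 := / Gamma (1 + (A + 2) / 2 - B)) in *.
  transitivity ((1 + A / 2) * g1 * g2 * ((1 + A - B) * (2 + A - B) * K0)); [ring|].
  rewrite R.
  transitivity ((1 + A / 2) * (1 + A) * (2 + A - 2 * B) * (g1 * g2 * K1)); [ring|].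
  rewrite E1. field.
Qed.

(** * Multisection *)

(** The odd terms cancel in the half sum of the partial sums up to 2n, so no absolute convergence is
    involved. *)
Lemma is_series_even (u : nat -> C) (l l' : C) :
  is_series u l -> is_series (fun n => (-1)^n * u n) l' ->
  is_series (fun n => u (2 * n)%nat) ((l + l') / 2).
Proof.
intros H H'. apply is_series_sum_n.
apply Clim_ext with (fun n => (sum_n u (2 * n) + sum_n (fun n => (-1)^n * u n) (2 * n)) * / 2).
- induction n as [|n IH].
  + rewrite !sum_O. simpl. field.
  + replace (2 * S n)%nat with (S (S (2 * n))) by lia.
    rewrite !sum_n_C_S. replace (2 * S n)%nat with (S (S (2 * n))) by lia. rewrite <- IH.
    assert (E : (-1)^(2 * n) = 1).
    { rewrite Cpow_mult_r. replace ((-1)^2) with (RtoC 1) by (simpl; ring). apply Cpow_1_l. }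
    change ((-1)^(S (S (2 * n)))) with (-1 * (-1 * (-1)^(2 * n))).
    change ((-1)^(S (2 * n))) with (-1 * (-1)^(2 * n)). rewrite E. field.
- assert (sub : forall v (x : C), Clim v x -> Clim (fun n => v (2 * n)%nat) x).
  { intros v x. rewrite !Clim_Cmod_iff. intros L.
    apply (is_lim_seq_subseq (fun n => Cmod (v n - x)) 0%R (fun n => 2 * n)%nat); [|exact L].
    apply eventually_subseq. intros n. lia. }
  unfold Cdiv. apply Clim_mult; [|apply Clim_const].
  apply Clim_plus; [apply (sub (sum_n u))|apply (sub (sum_n (fun n => (-1)^n * u n)))]; assumption.
Qed.

Lemma pochhammer_double (z : C) (n : nat) :
  pochhammer (2 * z) (2 * n) = 4^n * (pochhammer z n * pochhammer (z + 1/2) n).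
Proof.
induction n as [|n IH]; [simpl; ring|].
replace (2 * S n)%nat with (S (S (2 * n))) by lia.
rewrite !pochhammer_S, IH, !RtoC_INR_S, mult_INR, RtoC_mult.
change (4^(S n)) with (4 * 4^n). replace (RtoC (INR 2)) with (RtoC 2) by reflexivity.
field.
Qed.

Lemma pochhammer_quadruple (z : C) (n : nat) :
  pochhammer (4 * z) (2 * (2 * n)) = 4^(2 * n) * (4^n * 4^n) *
   (pochhammer z n * pochhammer (z + 1/2) n * pochhammer (z + 1/4) n * pochhammer (z + 3/4) n).
Proof.
replace (4 * z) with (2 * (2 * z)) by ring.
rewrite pochhammer_double, pochhammer_double.
replace (2 * z + 1/2) with (2 * (z + 1/4)) by field.
rewrite pochhammer_double. replace (z + 1/4 + 1/2) with (z + 3/4) by field. ring.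
Qed.

Lemma nonpos_int_half (z : C) :
  nonpos_int (2 * z) -> nonpos_int z \/ nonpos_int (z + 1/2).
Proof.
intros [n E]. destruct (Nat.Even_or_Odd n) as [[m ->]|[m ->]].
- left. exists m. replace z with (2 * z / 2) by field. rewrite E, mult_INR, RtoC_mult.
  replace (RtoC (INR 2)) with (RtoC 2) by reflexivity. field.
- right. exists m. replace z with (2 * z / 2) by field.
  rewrite E, plus_INR, mult_INR, RtoC_plus, RtoC_mult.
  replace (RtoC (INR 2)) with (RtoC 2) by reflexivity. simpl (INR 1). field.
Qed.

(** With [/ 0 = 0] no condition is required. This splits the denominators of the theorem, in which a
    Gamma value may be the conventional 0 at a pole. *)
Lemma Cinv_mult_all (x y : C) : / (x * y) = / x * / y.
Proof.
destruct (Ceq_dec x 0) as [->|hx]; [rewrite Cmult_0_l, Cinv_0; ring|].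
destruct (Ceq_dec y 0) as [->|hy]; [rewrite Cmult_0_r, Cinv_0; ring|].
field. split; assumption.
Qed.

(** Quadruplication of each Pochhammer symbol; the powers of 4 cancel, there being two symbols above
    and two below. *)
Lemma hyp8F8_term_gauss (a b : C) (k : nat) :
  Forall (fun c => ~ nonpos_int c)
    [RtoC 1; 1/2; 1/4; 3/4; 1/2 + a - b; 1 + a - b; 1/4 + a - b; 3/4 + a - b] ->
  hypF_term
    [a; a + 1/2; a + 1/4; a + 3/4; b; b + 1/2; b + 1/4; b + 3/4]
    [RtoC 1; 1/2; 1/4; 3/4; 1/2 + a - b; 1 + a - b; 1/4 + a - b; 3/4 + a - b] 1 k =
  gauss_term (4 * a) (4 * b) (1 + 4 * a - 4 * b) (2 * (2 * k)).
Proof.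
intros H. rewrite !Forall_cons_iff in H.
destruct H as [h1 [h2 [h3 [h4 [h5 [h6 [h7 [h8 _]]]]]]]].
unfold hypF_term, gauss_term. simpl map. unfold Cprod. simpl fold_right.
rewrite Cpow_1_l.
(* (4k)! is (1)_(4k), and quadruplication at z = 1/4 produces the lower parameters 1/4, 1/2, 3/4 and
   1. *)
replace (RtoC (INR (fact (2 * (2 * k))))) with (pochhammer (4 * (1/4)) (2 * (2 * k)))
  by (rewrite <- pochhammer_1; f_equal; field).
replace (1 + 4 * a - 4 * b) with (4 * (1/4 + a - b)) by field.
rewrite !pochhammer_quadruple.
replace (1/4 + 1/2) with (3/4 : C) by field. replace (1/4 + 1/4) with (1/2 : C) by field.
replace (1/4 + 3/4) with (RtoC 1) by field.
replace (1/4 + a - b + 1/2) with (3/4 + a - b) by field.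
replace (1/4 + a - b + 1/4) with (1/2 + a - b) by field.
replace (1/4 + a - b + 3/4) with (1 + a - b) by field.
assert (F : forall n, 4 ^ n <> 0) by (intros; apply Cpow_nz; intros E; apply RtoC_inj in E; lra).
field. repeat split; auto using pochhammer_neq_0.
Qed.

(* The duplication formula exhibits this series as the well-poised one with
   parameters [2a; 2a + 1/2, 2b, 2b + 1/2]. *)
Lemma alternating_even_sum (a b : C) :
  (Re b < 1 / 8)%R ->
  ~ nonpos_int (1 + 2 * a) -> ~ nonpos_int (1 + 2 * a - 2 * b) ->
  ~ nonpos_int (1/2 + 2 * a - 2 * b) ->
  ex_series (hypF_term [1/2 - a; 2 * b; 2 * b + 1/2] [RtoC 1; 1 + a; 1/2] 1) ->
  is_series (fun n => (-1)^n * gauss_term (4 * a) (4 * b) (1 + 4 * a - 4 * b) (2 * n))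
    (Gamma (1 + 2 * a - 2 * b) * Gamma (1/2 + 2 * a - 2 * b)
       * / Gamma (1 + 2 * a) * / Gamma (1/2 + 2 * a - 4 * b)
       * hypF [1/2 - a; 2 * b; 2 * b + 1/2] [RtoC 1; 1 + a; 1/2] 1).
Proof.
intros Hb H1 H2 H3 Hex.
set (c := 2 * a + 1/2).
assert (Ec : 1 + 2 * a - c = 1/2) by (unfold c; field).
assert (Ea : 1 + 2 * a / 2 = 1 + a) by field.
assert (Ep : 1 + 2 * a / 2 - c = 1/2 - a) by (unfold c; field).
assert (Ee : 1 + 2 * a - (2 * b + 1/2) = 1/2 + 2 * a - 2 * b) by field.
assert (Es : 1 + 2 * a - 2 * b - (2 * b + 1/2) = 1/2 + 2 * a - 4 * b) by field.
assert (Hhalf : ~ nonpos_int (1/2)).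
{ apply Re_pos_not_nonpos_int. simpl. lra. }
assert (H4 : ~ nonpos_int (1 + a)) by (rewrite <- Ea; now apply half_not_nonpos_int).
assert (term : forall m, hypF_term [1/2 - a; 2 * b; 2 * b + 1/2] [RtoC 1; 1 + a; 1/2] 1 m =
  pochhammer (1/2 - a) m / (INR (fact m) * pochhammer (1 + a) m * pochhammer (1/2) m)
      * (pochhammer (2 * b) m * pochhammer (2 * b + 1/2) m)).
{ intros m. unfold hypF_term. simpl map. unfold Cprod. simpl fold_right.
  rewrite Cpow_1_l, pochhammer_1. field.
  repeat split; auto using RtoC_fact_neq_0, pochhammer_neq_0. }
assert (Rs : Re (1/2 + 2 * a - 4 * b) = (1/2 + 2 * Re a - 4 * Re b)%R).
{ destruct a as [x y], b as [x' y']. unfold Re, Cminus, Cdiv, Cmult, Cinv, Cplus, Copp, RtoC. simpl. field. }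
assert (Rc : Re c = (2 * Re a + 1/2)%R).
{ unfold c. destruct a as [x y]. unfold Re, Cdiv, Cmult, Cinv, Cplus, RtoC. simpl. field. }
assert (Hcv : bailey_cvg (2 * a) c (2 * b) (2 * b + 1/2)).
{ unfold bailey_cvg. rewrite Es, Rs, Rc.
  destruct (Classical_Prop.classic (nonpos_int (2 * b) \/ nonpos_int (2 * b + 1/2))) as [h|h];
    [now left|right].
  (* The second inequality reads 4 Re b < 1/2, which is [Hb]. *)
  split; [|lra].
  apply Rnot_le_lt. intros hs.
  apply (hyp3F2_not_ex_series (1/2 - a) (2 * b) (2 * b + 1/2) (1 + a) (1/2)); auto.
  (* Termination through 1/2 - a = -n would give Re a >= 1/2, and with Re b < 1/8 the excess would
     be positive, against [hs]. *)
  - intros [n E].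
    assert (T : Re (1/2 - a) = (- INR n)%R) by (rewrite E; reflexivity).
    replace (Re (1/2 - a)) with (1/2 - Re a)%R in T
      by (destruct a as [x y]; unfold Re, Cminus, Cdiv, Cmult, Cinv, Cplus, Copp, RtoC; simpl; field).
    assert (P := pos_INR n). lra.
  - replace (1 + a + 1/2 - (1/2 - a) - 2 * b - (2 * b + 1/2)) with (1/2 + 2 * a - 4 * b) by field.
    now rewrite Rs.
  - destruct Hex as [l Hl]. exists l. apply is_series_ext with (2 := Hl). exact term. }
destruct (well_poised_transformation (2 * a) c (2 * b) (2 * b + 1/2)) as [l [L1 L2]];
  rewrite ?Ec, ?Ee; auto.
rewrite Es, Ee in L2.
unfold hypF. rewrite (CSeries_unique _ l).
- apply is_series_ext with (2 := L2). intros n.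
  C_eq.
  unfold bailey_alpha, bailey_delta, gauss_term. rewrite Ec, <- pochhammer_1.
  replace (4 * a) with (2 * (2 * a)) by ring. replace (4 * b) with (2 * (2 * b)) by ring.
  replace (1 + 2 * (2 * a) - 2 * (2 * b)) with (2 * (1/2 + 2 * a - 2 * b)) by field.
  rewrite <- (pochhammer_1 (2 * n)).
  replace (pochhammer 1 (2 * n)) with (pochhammer (2 * (1/2)) (2 * n)) by (f_equal; field).
  rewrite !pochhammer_double.
  replace (1/2 + 1/2) with (RtoC 1) by field.
  replace (1/2 + 2 * a - 2 * b + 1/2) with (1 + 2 * a - 2 * b) by field.
  assert (F : 4 ^ n <> 0) by (apply Cpow_nz; intros E; apply RtoC_inj in E; lra).
  assert (H0 : ~ nonpos_int 1) by (apply Re_pos_not_nonpos_int; simpl; lra).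
  unfold c. field. repeat split; auto using pochhammer_neq_0.
- apply is_series_ext with (2 := L1). intros m. rewrite term, Ep, Ea, Ec. reflexivity.
Qed.

Theorem corollary5p16 :
  forall a b : C,
  (Re b < 1 / 8)%R ->
  (* both series are defined *)
  Forall (fun c => ~ nonpos_int c)
    [RtoC 1; 1/2; 1/4; 3/4; 1/2 + a - b; 1 + a - b; 1/4 + a - b; 3/4 + a - b] ->
  Forall (fun c => ~ nonpos_int c) [RtoC 1; 1 + a; 1/2] ->
  ex_series (hypF_term [1/2 - a; 2 * b; 2 * b + 1/2] [RtoC 1; 1 + a; 1/2] 1) ->
  (* the numerator Gamma(1+2a) is not at a pole *)
  ~ nonpos_int (1 + 2 * a) ->
  is_series
    (hypF_term
       [a; a + 1/2; a + 1/4; a + 3/4; b; b + 1/2; b + 1/4; b + 3/4]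
       [RtoC 1; 1/2; 1/4; 3/4; 1/2 + a - b; 1 + a - b; 1/4 + a - b; 3/4 + a - b]
       1)
    (1/4 * (Gamma (1 + 4 * a - 4 * b) * Gamma (1 - 8 * b)
              / (Gamma (1 - 4 * b) * Gamma (1 + 4 * a - 8 * b))
            + Gamma (1 + 4 * a - 4 * b) * Gamma (1 + 2 * a)
              / (Gamma (1 + 4 * a) * Gamma (1 + 2 * a - 4 * b)))
     + Gamma (1 + 2 * a - 2 * b) * Gamma (1/2 + 2 * a - 2 * b)
       / (2 * Gamma (1 + 2 * a) * Gamma (1/2 + 2 * a - 4 * b))
       * hypF [1/2 - a; 2 * b; 2 * b + 1/2] [RtoC 1; 1 + a; 1/2] 1).
Proof.
intros a b Hb Hlow _ Hex H1.
assert (Hlow' := Hlow). rewrite !Forall_cons_iff in Hlow'.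
destruct Hlow' as [_ [_ [_ [_ [h5 [h6 [h7 [h8 _]]]]]]]].
(* By [nonpos_int_half], a doubled argument is a pole only if one of the two arguments it comes from
   is; this reduces [H2] to [H4] to the lower parameters of the 8F8. *)
assert (H2 : ~ nonpos_int (1 + 2 * a - 2 * b)).
{ replace (1 + 2 * a - 2 * b) with (2 * (1/2 + a - b)) by field.
  intros h. destruct (nonpos_int_half _ h) as [k|k]; [now apply h5|apply h6].
  replace (1 + a - b) with (1/2 + a - b + 1/2) by field. exact k. }
assert (H3 : ~ nonpos_int (1/2 + 2 * a - 2 * b)).
{ replace (1/2 + 2 * a - 2 * b) with (2 * (1/4 + a - b)) by field.
  intros h. destruct (nonpos_int_half _ h) as [k|k]; [now apply h7|apply h8].
  replace (3/4 + a - b) with (1/4 + a - b + 1/2) by field. exact k. }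
assert (H4 : ~ nonpos_int (1 + 4 * a - 4 * b)).
{ replace (1 + 4 * a - 4 * b) with (2 * (1/2 + 2 * a - 2 * b)) by field.
  intros h. destruct (nonpos_int_half _ h) as [k|k]; [now apply H3|apply H2].
  replace (1 + 2 * a - 2 * b) with (1/2 + 2 * a - 2 * b + 1/2) by field. exact k. }
assert (R4 : (Re (4 * b) < 1 / 2)%R) by (destruct b; simpl in *; lra).
assert (R8 : (0 < Re (1 - 8 * b))%R) by (destruct b; simpl in *; lra).
assert (H5 := Re_pos_not_nonpos_int _ R8).
destruct (gauss_summation (4 * a) (4 * b) (1 + 4 * a - 4 * b) H4) as [S1 [L1 E1]].
{ right; right. replace (1 + 4 * a - 4 * b - 4 * a - 4 * b) with (1 - 8 * b) by ring. exact R8. }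
destruct (kummer_summation (4 * a) (4 * b) H4 R4) as [S2 [L2 E2]].
assert (L3 := alternating_even_sum a b Hb H1 H2 H3 Hex).
(* The inner bisection gives the even terms of T, the outer one those with index divisible by 4, so
   the value is ((S1 + S2) / 2 + S3) / 2. *)
assert (L4 := is_series_even _ _ _ (is_series_even _ _ _ L1 L2) L3).
apply is_series_ext with (b := hypF_term
       [a; a + 1/2; a + 1/4; a + 3/4; b; b + 1/2; b + 1/4; b + 3/4]
       [RtoC 1; 1/2; 1/4; 3/4; 1/2 + a - b; 1 + a - b; 1/4 + a - b; 3/4 + a - b]
       1) in L4; [|intros n; symmetry; now apply hyp8F8_term_gauss].
replace (1 + 4 * a - 4 * b - 4 * a - 4 * b) with (1 - 8 * b) in E1 by ring.
replace (1 + 4 * a - 4 * b - 4 * a) with (1 - 4 * b) in E1 by ring.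
replace (1 + 4 * a - 4 * b - 4 * b) with (1 + 4 * a - 8 * b) in E1 by ring.
replace (1 + 4 * a / 2) with (1 + 2 * a) in E2 by field.
assert (G4 := Gamma_neq_0 _ H4). assert (G5 := Gamma_neq_0 _ H5). assert (G1 := Gamma_neq_0 _ H1).
(* Only the two Gamma values on the left are cleared; those kept as reciprocals in v may be at
   poles. *)
assert (cancel : forall x y s v : C, x <> 0 -> y <> 0 -> / x * / y * s = v -> s = x * y * v).
{ intros x y s v hx hy <-. field. split; assumption. }
assert (V1 : S1 = Gamma (1 + 4 * a - 4 * b) * Gamma (1 - 8 * b) *
   (/ Gamma (1 - 4 * b) * / Gamma (1 + 4 * a - 8 * b))).
{ exact (cancel _ _ _ _ G4 G5 E1). }
assert (V2 : S2 = Gamma (1 + 4 * a - 4 * b) * Gamma (1 + 2 * a) *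
   (/ Gamma (1 + 4 * a) * / Gamma (1 + 2 * a - 4 * b))).
{ exact (cancel _ _ _ _ G4 G1 E2). }
unfold Cdiv in *.
match goal with |- is_series _ ?v => match type of L4 with is_series _ ?w => replace v with w; [exact L4|] end end.
rewrite V1, V2, !Cinv_mult_all.
C_eq.
(* The remaining inverses stay atoms for [ring]: [field] would ask that Gamma values which may be 0
   be nonzero. *)
set (i := / 2).
assert (I : RtoC 1 * / 4 = i * i) by (unfold i; field).
rewrite I. ring.
Qed.
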